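(* Let the sequences be generated by Algorithm 2 (described in the context), assumed not to stop, where each $F_i$ is $L_i^{-1}$-cocoercive ($L_i>0$), i.e. $\langle F_i(x)-F_i(y),x-y\rangle\ge\frac1{L_i}\|F_i(x)-F_i(y)\|^2$ for all $x,y\in\operatorname{Dom}F_i$, $i=1,\dots,n$. Let $d_{0,\gamma}$ denote the distance, in the norm $\|\cdot\|_\gamma$, of $p^0$ to $\mathcal S_e$, and let $\overline L:=\max_{i=1,\dots,n}L_i$, $\underline L:=\min_{i=1,\dots,n}L_i$. Suppose that $\overline\alpha:=\sup_{k\ge0}\alpha_k<+\infty$ and $\overline s:=\sum_{k=0}^\infty\beta_k^2<+\infty$; put $\overline\beta:=\sup_{k\ge0}\beta_k$ and $$\Omega_{(\alpha,\beta)}:=(1+\overline\alpha)\Big[(1+\overline\beta)\big[1+\overline\alpha(1+\overline\beta)\big]+\overline s\Big].$$ Then: (a) (Strong convergence) With $p^k=(z^k,w_1^k,\dots,w_{n-1}^k)$ and $w_n^k:=-\sum_{i=1}^{n-1}G_i^*w_i^k$, the sequence $(p^k)$ converges strongly to $p^*:=(z^*,w_1^*,\dots,w_{n-1}^* )$, the orthogonal projection (with respect to $\langle\cdot,\cdot\rangle_\gamma$) of $p^0$ onto $\mathcal S_e$; $(z^k)$ converges strongly to $z^*$, which is a solution of $0\in\sum_{i=1}^nG_i^*(F_i+B_i)(G_iz)$; $(w_i^k)$ converges strongly to $w_i^*$ for $1\le i\le n$, where $w_n^*:=-\sum_{i=1}^{n-1}G_i^*w_i^*$; and, for $i=1,\dots,n$,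 $(x_i^k)$ and $(y_i^k)$ converge strongly to $G_iz^*$ and $w_i^*$, respectively. (b) (Iteration-complexity) For all $k\ge0$ there exists $\ell\in\{0,1,\dots,k\}$ such that $$y_i^\ell\in(F_i^{[\varepsilon_i^\ell]}+B_i)(x_i^\ell),\quad i=1,\dots,n,$$ $$\Big\|\sum_{i=1}^{n-1}G_i^*y_i^\ell+y_n^\ell\Big\|\le\frac{n\big(\max_{i=1,\dots,n}\|G_i\|^2\big)\max\big\{\frac{\overline L}{2\sigma^2},\frac{2\sigma^2}{\underline L}\big\}d_{0,\gamma}}{\sqrt{k+1}}\left(\frac{4\sqrt\gamma\max\{1,1/\gamma\}\sqrt{\Omega_{(\alpha,\beta)}}}{1-\sigma^2}\right),$$ $$\|x_i^\ell-G_ix_n^\ell\|\le\frac{n\big(\max_{i=1,\dots,n}\|G_i\|^2\big)\max\big\{\frac{\overline L}{2\sigma^2},\frac{2\sigma^2}{\underline L}\big\}d_{0,\gamma}}{\sqrt{k+1}}\left(\frac{4\max\{1,1/\gamma\}\sqrt{\Omega_{(\alpha,\beta)}}}{1-\sigma^2}\right),\quad i=1,\dots,n-1,$$ $$\sum_{i=1}^n\varepsilon_i^\ell\le\frac{n\big(\max_{i=1,\dots,n}\|G_i\|^2\big)\max\big\{\frac{\overline L}{2\sigma^2},\frac{2\sigma^2}{\underline L}\big\}d_{0,\gamma}^2}{k+1}\left(\frac{4\sigma^2\max\{1,1/\gamma\}\,\Omega_{(\alpha,\beta)}}{(1-\sigma^2)^2}\right).$$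
   Context: Setting. Let $n\ge2$, let $\mathcal H_0,\dots,\mathcal H_{n-1}$ be real Hilbert spaces, and $\mathcal H_n:=\mathcal H_0$; inner products and norms are written $\langle\cdot,\cdot\rangle$ and $\|\cdot\|$. For $i=1,\dots,n$: $F_i:\operatorname{Dom}F_i\subseteq\mathcal H_i\to\mathcal H_i$ is a single-valued continuous monotone map; $B_i:\mathcal H_i\rightrightarrows\mathcal H_i$ is a set-valued maximal monotone operator with $\operatorname{Dom}B_i\subseteq C_i\subseteq\operatorname{Dom}F_i$, where $C_i$ is a nonempty closed convex subset of $\mathcal H_i$; $G_i:\mathcal H_0\to\mathcal H_i$ is a bounded linear operator with adjoint $G_i^*$ and operator norm $\|G_i\|$, and $G_n=I$ is the identity. The problem is to find $z\in\mathcal H_0$ with $0\in\sum_{i=1}^nG_i^*(F_i+B_i)(G_iz)$; it is assumed to have at least one solution. Put $T_i:=F_i+B_i$ (maximal monotone; single-valued maps are identified with set-valued ones, empty outside their domain). For a set-valued map $T$ and $\varepsilon\ge0$, $T^{[\varepsilon]}(x)=\{u:\langle x-y,u-v\rangle\ge-\varepsilon\text{ for all }y\text{ and all }v\in T(y)\}$. For $\gamma>0$, $\boldsymbol{\mathcal H}:=\mathcal H_0\times\dots\times\mathcal H_{n-1}$ carries $\langle (z,w),(z',w')\rangle_\gamma=\gamma\langle z,z'\rangle+\sum_{i=1}^{n-1}\langle w_i,w_i'\rangle$ and $\|p\|_\gamma=\sqrt{\langle p,p\rangle_\gamma}$. $P_C$ denotes orthogonal projection onto a nonempty closed convex set $C$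 (for subsets of $\boldsymbol{\mathcal H}$, with respect to $\langle\cdot,\cdot\rangle_\gamma$). The extended-solution set is the (nonempty closed convex) set $$\mathcal S_e=\Big\{(z,w_1,\dots,w_{n-1})\in\boldsymbol{\mathcal H}: w_i\in T_i(G_iz),\ i=1,\dots,n-1,\ -\sum_{i=1}^{n-1}G_i^*w_i\in T_n(z)\Big\}.$$ Algorithm 2. Input: $p^{-1}=p^0=(z^0,w_1^0,\dots,w_{n-1}^0)\in\boldsymbol{\mathcal H}$ (so $z^{-1}=z^0$, $w_i^{-1}=w_i^0$), $0<\sigma<1$, $\gamma>0$; set $\lambda_i=2\sigma^2/L_i$ for $i=1,\dots,n$. For $k=0,1,\dots$: (1) Choose $\alpha_k,\beta_k\ge0$ and set $\widehat z^k=z^k+\alpha_k(z^k-z^{k-1})$, $\widetilde z^k=\widehat z^k+\beta_k(\widehat z^k-z^0)$; for $i=1,\dots,n-1$: $\widehat w_i^k=w_i^k+\alpha_k(w_i^k-w_i^{k-1})$, $\widetilde w_i^k=\widehat w_i^k+\beta_k(\widehat w_i^k-w_i^0)$; and $\widetilde w_n^k=-\sum_{i=1}^{n-1}G_i^*\widetilde w_i^k$. (2) For $i=1,\dots,n$, let $\overline z_i^k:=P_{C_i}(G_i\widetilde z^k)$, $x_i^k:=(\lambda_iB_i+I)^{-1}\big(G_i\widetilde z^k+\lambda_i\widetilde w_i^k-\lambda_iF_i(\overline z_i^k)\big)$ and $y_i^k:=\frac1{\lambda_i}\big(G_i\widetilde z^k+\lambda_i\widetilde w_i^k-x_i^k\big)$.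 (3) If $x_i^k=G_ix_n^k$ for $i=1,\dots,n-1$ and $\sum_{i=1}^{n-1}G_i^*y_i^k+y_n^k=0$, stop and return $(x_n^k,y_1^k,\dots,y_{n-1}^k)$. (4) Otherwise let $\varepsilon_i^k:=\frac{L_i\|x_i^k-\overline z_i^k\|^2}{4}$ for $i=1,\dots,n$; let $\varphi_k(p)=\sum_{i=1}^n\big(\langle G_iz-x_i^k,y_i^k-w_i\rangle-\varepsilon_i^k\big)$ for $p=(z,w_1,\dots,w_{n-1})$, with $w_n:=-\sum_{i=1}^{n-1}G_i^*w_i$; let $p^k=(z^k,w_1^k,\dots,w_{n-1}^k)$, $H_k=\{p:\varphi_k(p)\le0\}$, $W_k=\{p:\langle p^0-p^k,p-p^k\rangle_\gamma\le0\}$, and set $p^{k+1}=(z^{k+1},w_1^{k+1},\dots,w_{n-1}^{k+1})=P_{H_k\cap W_k}(p^0)$. *)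

(* Defs.v *)
From HB Require Import structures.
From mathcomp Require Import all_boot all_order all_algebra.
From mathcomp Require Import all_classical all_reals all_analysis.

Set Implicit Arguments.
Unset Strict Implicit.
Unset Printing Implicit Defensive.

Import Order.TTheory GRing.Theory Num.Theory.
Import numFieldNormedType.Exports.

Local Open Scope classical_set_scope.
Local Open Scope ring_scope.

HB.mixin Record CompleteNormedModule_isHilbert (R : realType) (V : Type)
    of CompleteNormedModule R V := {
  inner : {dot V for idfun} ;
  inner_normE : forall x : V, inner x x = `|x| ^+ 2
}.

#[short(type="hilbertType")]
HB.structure Definition Hilbert (R : realType) :=
  {V of CompleteNormedModule R V & CompleteNormedModule_isHilbert R V}.

Notation "''[' x , y ]" := (inner x y)
  (format "''[' x ,  y ]") : ring_scope.

(* d x p is minimal over C, that is, p = P_C(x) when C is a nonempty closed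
   convex subset of a Hilbert space with distance d. *)
Definition nearest (R : realType) (T : Type) (d : T -> T -> R) (C : set T)
    (x p : T) : Prop :=
  C p /\ forall q, C q -> d x p <= d x q.

Definition opnorm (R : realType) (V W : hilbertType R) (f : V -> W) : R :=
  sup [set `|f x| | x in [set x : V | `|x| <= 1]].

(* A x u reads: u is in A(x). *)
Section Operators.
Variables (R : realType) (V : hilbertType R).
Implicit Types (A B : V -> set V) (D C : set V) (x y u v : V).

Definition opdom A : set V := [set x | A x !=set0].

Definition monotone_op A : Prop :=
  forall x y u v, A x u -> A y v -> 0 <= '[x - y, u - v].

Definition maximal_monotone A : Prop :=
  monotone_op A /\
  forall A', monotone_op A' -> (forall x, A x `<=` A' x) ->
    forall x, A' x `<=` A x.

(* The set-valued operator of the single-valued map f with domain D; the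
   values of f outside D are irrelevant. *)
Definition single D (f : V -> V) : V -> set V :=
  fun x => [set u | D x /\ u = f x].

Definition opadd A B : V -> set V :=
  fun x => [set u + v | u in A x & v in B x].

Definition enlargement A (e : R) : V -> set V :=
  fun x => [set u | forall y v, A y v -> - e <= '[x - y, u - v]].

(* (lam A + I)^-1 as a set-valued operator *)
Definition resolvent (lam : R) A : V -> set V :=
  fun u => [set x | exists2 a, A x a & lam *: a + x = u].

Definition cocoercive (L : R) D (f : V -> V) : Prop :=
  forall x y, D x -> D y -> L^-1 * `|f x - f y| ^+ 2 <= '[f x - f y, x - y].

End Operators.

(* The indices 1, ..., n are encoded by [option 'I_n.-1]: [Some j] is j + 1
   and [None] is n, so that H_n = H_0 holds definitionally. *)
Section Product.
Variables (R : realType) (n : nat).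
Variables (H0 : hilbertType R) (H : 'I_n.-1 -> hilbertType R).

Definition hsp (i : option 'I_n.-1) : hilbertType R :=
  if i is Some j then H j else H0.

Record ext := Ext { zpart : H0 ; wpart : forall j : 'I_n.-1, H j }.

Let ext_eq p q : zpart p = zpart q -> (forall j, wpart p j = wpart q j) ->
  p = q.
Proof.
by case: p q => [z w] [z' w'] /= -> ww'; congr Ext; exact: functional_extensionality_dep.
Qed.

Let ext0 := Ext 0 (fun=> 0).
Let extN p := Ext (- zpart p) (fun j => - wpart p j).
Let extD p q := Ext (zpart p + zpart q) (fun j => wpart p j + wpart q j).
Let extZ (a : R) p := Ext (a *: zpart p) (fun j => a *: wpart p j).

Let extDA : associative extD.
Proof. by move=> p q r; apply: ext_eq => [|j]; exact: addrA. Qed.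
Let extDC : commutative extD.
Proof. by move=> p q; apply: ext_eq => [|j]; exact: addrC. Qed.
Let ext0D : left_id ext0 extD.
Proof. by move=> p; apply: ext_eq => [|j]; exact: add0r. Qed.
Let extND : left_inverse ext0 extN extD.
Proof. by move=> p; apply: ext_eq => [|j]; exact: addNr. Qed.

HB.instance Definition _ := gen_eqMixin ext.
HB.instance Definition _ := gen_choiceMixin ext.
HB.instance Definition _ := GRing.isZmodule.Build ext extDA extDC ext0D extND.

Let extZA a b p : extZ a (extZ b p) = extZ (a * b) p.
Proof. by apply: ext_eq => [|j]; exact: scalerA. Qed.
Let ext1Z : left_id 1 extZ.
Proof. by move=> p; apply: ext_eq => [|j]; exact: scale1r. Qed.
Let extZDr : right_distributive extZ +%R.
Proof. by move=> a p q; apply: ext_eq => [|j]; exact: scalerDr. Qed.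
Let extZDl p : {morph extZ^~ p : a b / a + b}.
Proof. by move=> a b; apply: ext_eq => [|j]; exact: scalerDl. Qed.

HB.instance Definition _ :=
  GRing.Zmodule_isLmodule.Build R ext extZA ext1Z extZDr extZDl.

Definition gdot (g : R) (p q : ext) : R :=
  g * '[zpart p, zpart q] + \sum_j '[wpart p j, wpart q j].

Definition gnorm (g : R) (p : ext) : R := Num.sqrt (gdot g p p).

Definition gdist (g : R) (p q : ext) : R := gnorm g (p - q).

End Product.

Section Problem.
Variables (R : realType) (n : nat).
Variables (H0 : hilbertType R) (H : 'I_n.-1 -> hilbertType R).
Notation idx := (option 'I_n.-1).
Notation hs := (hsp H0 H).
Notation ext := (ext H0 H).
Unset Implicit Arguments.
Variables (domF C : forall i : idx, set (hs i)) (F : forall i : idx, hs i -> hs i).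
Variables (B : forall i : idx, hs i -> set (hs i)).
Variables (G : forall i : idx, H0 -> hs i) (Gadj : forall i : idx, hs i -> H0).
Set Implicit Arguments.

Definition Top (i : idx) : hs i -> set (hs i) :=
  opadd (single (domF i) (F i)) (B i).

Definition solution (z : H0) : Prop :=
  [set \sum_i Gadj i (u i) |
     u in [set u : forall i, hs i | forall i, @Top i (G i z) (u i)]] 0.

(* the vectors w_1, ..., w_n, where w_n is minus the sum of the G_j^* w_j *)
Definition wfull (p : ext) (i : idx) : hs i :=
  match i return hs i with
  | Some j => wpart p j
  | None => - \sum_j Gadj (Some j) (wpart p j)
  end.

Definition ext_solutions : set ext :=
  [set p | (forall j, @Top (Some j) (G (Some j) (zpart p)) (wpart p j)) /\
           @Top None (zpart p) (- \sum_j Gadj (Some j) (wpart p j))].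

Variables (L : idx -> R) (sigma g : R).
Variables (alpha beta : nat -> R).

Definition stepsize (i : idx) : R := 2 * sigma ^+ 2 / L i.

Section Iterates.
Variables (p : nat -> ext) (zb x y : nat -> forall i : idx, hs i).

(* p^(-1) = p^0 is rendered by 0.-1 = 0 *)
Definition phat (k : nat) : ext := p k + alpha k *: (p k - p k.-1).

Definition ptilde (k : nat) : ext := phat k + beta k *: (phat k - p 0%N).

Definition residual (k : nat) : H0 :=
  \sum_j Gadj (Some j) (y k (Some j)) + y k None.

Definition stops (k : nat) : Prop :=
  (forall j, x k (Some j) = G (Some j) (x k None)) /\ residual k = 0.

Definition epsk (k : nat) (i : idx) : R :=
  L i * `|x k i - zb k i| ^+ 2 / 4.

Definition phik (k : nat) (q : ext) : R :=
  \sum_i ('[G i (zpart q) - x k i, y k i - wfull q i] - epsk k i).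

Definition Hk (k : nat) : set ext := [set q | phik k q <= 0].

Definition Wk (k : nat) : set ext :=
  [set q | gdot g (p 0%N - p k) (q - p k) <= 0].

(* The sequences are generated by the algorithm, which never stops. *)
Record algorithm2 : Prop := Algorithm2 {
  alg_alpha_ge0 : forall k, 0 <= alpha k ;
  alg_beta_ge0 : forall k, 0 <= beta k ;
  alg_zbar : forall k i,
    nearest (fun u v : hs i => `|u - v|) (C i) (G i (zpart (ptilde k))) (zb k i) ;
  alg_x : forall k i,
    resolvent (stepsize i) (B i)
      (G i (zpart (ptilde k)) + stepsize i *: wfull (ptilde k) i
       - stepsize i *: F i (zb k i)) (x k i) ;
  alg_y : forall k i,
    y k i = (stepsize i)^-1 *:
      (G i (zpart (ptilde k)) + stepsize i *: wfull (ptilde k) i - x k i) ;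
  alg_nostop : forall k, ~ stops k ;
  alg_next : forall k, nearest (@gdist R n H0 H g) (Hk k `&` Wk k) (p 0%N) (p k.+1)
}.

End Iterates.

Definition Lmax : R := \big[Num.max/L None]_i L i.
Definition Lmin : R := \big[Num.min/L None]_i L i.

(* The maximum starts from 1 = ||I||^2 = ||G_n||^2, so that it is the plain
   maximum of the ||G_i||^2 (see Gmax2E), with the convention ||I|| = 1 kept
   for H_0 = {0}, where opnorm gives 0. *)
Definition Gmax2 : R := \big[Num.max/1]_i opnorm (G i) ^+ 2.

Lemma Gmax2E : (exists z : H0, z != 0) -> (forall z, G None z = z) ->
  Gmax2 = \big[Num.max/0]_i opnorm (G i) ^+ 2.
Proof.
move=> [z z0] G1.
have G1E : opnorm (G None) = 1.
  rewrite /opnorm; apply/eqP; rewrite eq_le; apply/andP; split.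
    by apply: ge_sup; [exists 0, 0; rewrite /= ?G1 normr0|move=> _ /= [v v1 <-]; rewrite G1].
  apply: ub_le_sup; first by exists 1 => _ /= [v v1 <-]; rewrite G1.
  exists (`|z|^-1 *: z); rewrite /= ?G1 normrZ ger0_norm ?invr_ge0//;
    by rewrite mulVf ?normr_eq0.
apply/eqP; rewrite eq_le; apply/andP; split.
  apply: bigmax_le => [|i _]; last exact: le_bigmax.
  by rewrite -[leLHS](expr1n _ 2) -G1E; exact: le_bigmax.
by apply: bigmax_le => [|i _]; [exact: le_trans ler01 (bigmax_ge_id _ _ _ _)|exact: le_bigmax].
Qed.

Definition Omega : R :=
  let abar := sup (range alpha) in
  let bbar := sup (range beta) in
  let sbar := limn (series (fun k => beta k ^+ 2)) in
  (1 + abar) * ((1 + bbar) * (1 + abar * (1 + bbar)) + sbar).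

Definition d0 (p0 : ext) : R := inf [set gdist g p0 q | q in ext_solutions].

End Problem.

(* Main.v *)
Require Import Defs.
From HB Require Import structures.
From mathcomp Require Import all_boot all_order all_algebra.
From mathcomp Require Import all_classical all_reals all_analysis.
From mathcomp Require Import ring lra.
Set Implicit Arguments.
Unset Strict Implicit.
Unset Printing Implicit Defensive.
Import Order.TTheory GRing.Theory Num.Theory.
Import numFieldNormedType.Exports.
Local Open Scope classical_set_scope.
Local Open Scope ring_scope.

(** Let [phi_k] be the affine function of the algorithm.  Cocoercivity makes
    [F_i (zb_i)] an element of the [eps_i]-enlargement of [F_i] at [x_i], so
    [y_i] satisfies the monotonicity inequality of [T_i] up to [eps_i], and
    [phi_k <= 0] on the extended-solution set [S_e].  Hence [p^{k+1}] is the
    projection of [p^0] onto an outer approximation [H_k /\ W_k] of [S_e]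
    (Haugazeau's method), which gives [|p^k - p^0| <= d] and a square-summable
    sequence of increments [p^{k+1} - p^k].

    The choice [lam_i = 2 sigma^2 / L_i] bounds [eps_i] by a fraction of
    [|G_i z~ - x_i|^2 / lam_i]; the sum over [i] of these quantities is called
    the merit.  At the extrapolated point [phi_k] is at least
    [(1 - sigma^2) merit] ([merit_le_gap]), while the squared norm of its
    gradient, whose components are the residual and the differences
    [x_j - G_j x_n], is at most a constant times the merit ([grad_norm_le]).
    So the merit, the residuals and the errors are all controlled by the gap
    between the extrapolated point and [p^{k+1}] ([merit_grad_le]).  The squared
    gaps have a sum of at most [5/4 Omega d^2] ([inertial_gap_sum],
    [gap_sum_le]), and the smallest of the first [k + 1] gaps gives the
    complexity bounds ([complexity]).

    For strong convergence, [S_e] is written as an intersection of half-spaces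
    [sep a b <= 0], where [(a_i, b_i)] ranges over the graphs of the [T_i]
    ([ext_solutions_separator]): the separating functions are affine because
    [\sum_i G_i^* w_i = 0] removes their quadratic part.  The inclusion of the
    intersection in [S_e] is maximality of the [T_i], obtained from Minty's
    theorem ([minty]) and a contraction argument ([sum_resolvent]).  Each
    [sep a b] has a nonpositive upper limit along the iterates
    ([separator_limit]), and Haugazeau's argument concludes
    ([haugazeau_cvg]).  No weak topology appears: affine functions only see the
    closed convex hulls of the tails of a bounded sequence, and the asymptotic
    center of the sequence is a point in all of these hulls
    ([tail_hull_nonempty]).  This point, the projection of [p^0] onto [S_e] and
    the point required by Minty's theorem all come from a single minimization
    lemma for strongly convex functions ([prox_exists]). *)

(** * Complete inner products *)

(** Stated for a bare module, so that it covers the inner product of a space,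
    that of its square (where Fitzpatrick functions live) and [gdot g] on the
    extended space, which carries no topology of its own. *)
Record hilbert_form (R : realType) (E : lmodType R) (dt : E -> E -> R) : Prop :=
  HilbertForm {
    formC : forall x y, dt x y = dt y x ;
    formDl : forall x y z, dt (x + y) z = dt x z + dt y z ;
    formZl : forall a x y, dt (a *: x) y = a * dt x y ;
    form_ge0 : forall x, 0 <= dt x x ;
    form_complete : forall u : nat -> E,
      (forall e : R, 0 < e -> exists N, forall k l, (N <= k)%N -> (N <= l)%N ->
        dt (u k - u l) (u k - u l) <= e) ->
      exists c, forall e : R, 0 < e -> exists N, forall k, (N <= k)%N ->
        dt (u k - c) (u k - c) <= e
  }.

Section HilbertForm.
Variables (R : realType) (E : lmodType R) (dt : E -> E -> R).
Hypothesis hf : hilbert_form dt.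
Implicit Types (x y z v : E) (K : set E) (u : nat -> E).

Lemma formNl x y : dt (- x) y = - dt x y.
Proof. by rewrite -scaleN1r (formZl hf) mulN1r. Qed.

Lemma formDr x y z : dt x (y + z) = dt x y + dt x z.
Proof. by rewrite (formC hf) (formDl hf) !(formC hf _ x). Qed.

Lemma formZr a x y : dt x (a *: y) = a * dt x y.
Proof. by rewrite (formC hf) (formZl hf) (formC hf y). Qed.

Lemma formNr x y : dt x (- y) = - dt x y.
Proof. by rewrite (formC hf) formNl (formC hf y). Qed.

Lemma form0r x : dt x 0 = 0.
Proof. by rewrite -[X in dt x X](scale0r x) formZr mul0r. Qed.

Definition formE :=
  (formDl hf, formDr, formZl hf, formZr, formNl, formNr).

Lemma form_CS x y : dt x y ^+ 2 <= dt x x * dt y y.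
Proof.
have hx := form_ge0 hf x; have hy := form_ge0 hf y.
have [y0|y0] := eqVneq (dt y y) 0; last first.
  have := form_ge0 hf (dt y y *: x - dt x y *: y).
  rewrite !formE (formC hf y x) => h.
  have yp : 0 < dt y y by rewrite lt_neqAle eq_sym y0.
  have {}h : 0 <= dt y y * (dt x x * dt y y - dt x y ^+ 2) by nra.
  by move: h; rewrite pmulr_rge0// subr_ge0.
rewrite y0 mulr0.
have h s := form_ge0 hf (x + s *: y).
have {}h s : 0 <= dt x x + 2 * s * dt x y.
  by have := h s; rewrite !formE y0 (formC hf y x); lra.
(* were [dt x y] nonzero, this value of [s] would make the bound equal to -1 *)
have := h (- (dt x x + 1) * dt x y / (dt x y ^+ 2) / 2).
have [->|xy] := eqVneq (dt x y) 0; first by rewrite expr0n.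
have -> : dt x x + 2 * (- (dt x x + 1) * dt x y / dt x y ^+ 2 / 2) * dt x y = -1.
  by field.
by lra.
Qed.

Lemma form_young s x y : 0 < s -> 2 * dt x y <= s * dt x x + s^-1 * dt y y.
Proof.
move=> s0; have := form_ge0 hf (s *: x - y).
rewrite !formE (formC hf y x) => h.
have -> : s * dt x x + s^-1 * dt y y = s^-1 * (s ^+ 2 * dt x x + dt y y).
  by field; rewrite gt_eqF.
by rewrite ler_pdivlMl//; nra.
Qed.

(** Continuity of [dt v] at the origin. *)
Lemma form_small v e : 0 < e ->
  exists2 d, 0 < d & forall x, dt x x <= d -> `|dt v x| <= e.
Proof.
move=> e0; have hv := form_ge0 hf v.
exists (e ^+ 2 / (1 + dt v v)); first by rewrite divr_gt0 ?exprn_gt0//; lra.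
move=> x; rewrite ler_pdivlMr; last by lra.
move=> xd; rewrite -(@ler_pXn2r _ 2) ?nnegrE ?(ltW e0)// real_normK ?num_real//.
apply: le_trans (form_CS v x) _; have := form_ge0 hf x; nra.
Qed.

(** For [s] small the quadratic term [s^2 b] loses against the linear term
    [2 s a]; this is the limit [s -> 0] in first-order optimality conditions. *)
Lemma small_step (a b : R) : 0 < a -> 0 <= b ->
  exists s, [/\ 0 <= s <= 1, 0 < s & s * b < 2 * a].
Proof.
move=> a0 b0; have ab : 0 < a + b by lra.
exists (a / (a + b)); split.
- by apply/andP; split; [rewrite divr_ge0// ltW|rewrite ler_pdivrMr//; lra].
- by rewrite divr_gt0.
- by rewrite mulrAC ltr_pdivrMr//; nra.
Qed.

(** Along a segment from the minimizer [p], the squared distance to [x] is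
    [|x - p|^2 - 2 s <x - p, q - p> + s^2 |q - p|^2]; minimality at [s = 0]
    forces its derivative there to be nonnegative. *)
Lemma nearest_variational K x p :
  (forall a b (s : R), K a -> K b -> 0 <= s <= 1 -> K (a + s *: (b - a))) ->
  K p -> (forall q, K q -> dt (x - p) (x - p) <= dt (x - q) (x - q)) ->
  forall q, K q -> dt (x - p) (q - p) <= 0.
Proof.
move=> Kc Kp pmin q Kq; rewrite leNgt; apply/negP => h.
set a := dt (x - p) (q - p) in h; set b := dt (q - p) (q - p).
have b0 : 0 <= b := form_ge0 hf _.
have [s [s01 s0 sb]] := small_step h b0.
have := pmin _ (Kc _ _ _ Kp Kq s01).
have -> : x - (p + s *: (q - p)) = (x - p) - s *: (q - p) by rewrite opprD addrA.
move: (x - p) (q - p) @a @b h b0 sb => w v a b h b0 sb.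
rewrite !formE (formC hf v w) -/a -/b; nra.
Qed.

(** [P q t] is meant as the epigraph of a closed convex function [f]; the
    conclusion says that [- q0] is a subgradient of [f] at the minimizer [q0]
    of [f + |.|^2 / 2].  Minimizing sequences are Cauchy by the parallelogram
    identity, so that only completeness is used, and no weak topology. *)
Lemma prox_exists (P : E -> R -> Prop) (m : R) :
  (exists q t, P q t) ->
  (forall q t, P q t -> m <= t + dt q q / 2) ->
  (forall q t q' t' (s : R), P q t -> P q' t' -> 0 <= s <= 1 ->
     P (q + s *: (q' - q)) (t + s * (t' - t))) ->
  (forall q t, (forall e : R, 0 < e -> exists q' t',
     [/\ P q' t', dt (q' - q) (q' - q) <= e & `|t' - t| <= e]) -> P q t) ->
  exists q0 t0, P q0 t0 /\ forall q t, P q t -> t0 - dt q0 (q - q0) <= t.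
Proof.
move=> [q1 [t1 P1]] Pm Pconv Pclosed.
pose V := [set r | exists q t, P q t /\ r = t + dt q q / 2].
have Vinf : has_inf V.
  split; first by exists (t1 + dt q1 q1 / 2), q1, t1.
  by exists m => _ [q [t [Pqt ->]]]; exact: Pm.
have infP q t : P q t -> inf V <= t + dt q q / 2.
  by move=> Pqt; apply: ge_inf; [exact: Vinf.2|exists q, t].
have /choice[w wP] (k : nat) : exists w : E * R, P w.1 w.2 /\
    w.2 + dt w.1 w.1 / 2 <= inf V + k.+1%:R^-1.
  have [_ [q [t [Pqt ->]]] lt] : exists2 r, V r & r < inf V + k.+1%:R^-1.
    by apply: inf_adherent => //; rewrite invr_gt0.
  by exists (q, t); split=> //=; exact: ltW.
have cauchy k l : dt ((w k).1 - (w l).1) ((w k).1 - (w l).1) <=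
    4 * (k.+1%:R^-1 + l.+1%:R^-1).
  have [Pk vk] := wP k; have [Pl vl] := wP l.
  have h01 : 0 <= (2^-1 : R) <= 1 by lra.
  have := infP _ _ (Pconv _ _ _ _ _ Pl Pk h01).
  rewrite !formE (formC hf (w l).1 (w k).1).
  by move: k.+1%:R^-1 l.+1%:R^-1 vk vl => a b; lra.
have inv_small (e : R) : 0 < e -> exists N, forall k, (N <= k)%N -> k.+1%:R^-1 <= e :> R.
  move=> e0; exists (Num.truncn e^-1) => k Nk.
  rewrite -[e]invrK lef_pV2 ?posrE ?invr_gt0//.
  by apply: le_trans (ltW (truncnS_gt _)) _; rewrite ler_nat ltnS.
have [q0 q0P] : exists c, forall e : R, 0 < e -> exists N, forall k, (N <= k)%N ->
    dt ((w k).1 - c) ((w k).1 - c) <= e.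
  apply: (form_complete hf) => e e0.
  have e8 : 0 < e / 8 by lra.
  have [N NP] := inv_small _ e8.
  exists N => k l Nk Nl; apply: le_trans (cauchy k l) _.
  by move: k.+1%:R^-1 l.+1%:R^-1 (NP k Nk) (NP l Nl) => a b; lra.
pose t0 := inf V - dt q0 q0 / 2.
have P0 : P q0 t0.
  apply: Pclosed => e e0.
  have e3 : 0 < e / 3 by lra.
  have [d d0 dP] := form_small q0 e3.
  have [N1 N1P] := q0P _ d0.
  have [N2 N2P] := q0P _ e3.
  have [N3 N3P] := inv_small _ e3.
  pose k := maxn N1 (maxn N2 N3).
  have [Pk vk] := wP k.
  have h1 := N1P k (leq_maxl _ _).
  have h2 : dt ((w k).1 - q0) ((w k).1 - q0) <= e / 3.
    by apply: N2P; rewrite /k !leq_max leqnn orbT.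
  have h3 : k.+1%:R^-1 <= e / 3 by apply: N3P; rewrite /k !leq_max leqnn !orbT.
  move: k.+1%:R^-1 h3 vk => r h3 vk.
  exists (w k).1, (w k).2; split => //; first by lra.
  have := dP _ h1; rewrite !ler_norml /t0 => /andP[h4 h5].
  have h6 := infP _ _ Pk; have h7 := form_ge0 hf ((w k).1 - q0).
  move: h2 h4 h5 h7; rewrite !formE (formC hf _ q0) => h2 h4 h5 h7.
  by lra.
exists q0, t0; split=> // q t Pqt.
rewrite leNgt; apply/negP => h.
set a := t0 - dt q0 (q - q0) - t; set b := dt (q - q0) (q - q0).
have a0 : 0 < a by rewrite subr_gt0.
have b0 : 0 <= b := form_ge0 hf _.
have [s [s01 s0 sb]] := small_step a0 b0.
have := infP _ _ (Pconv _ _ _ _ _ P0 Pqt s01).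
move: (q - q0) @a @b h a0 b0 sb => v a b h a0 b0 sb.
rewrite !formE (formC hf v q0) -/b.
have -> : inf V = t0 + dt q0 q0 / 2 by rewrite /t0; lra.
by rewrite /a in a0 sb; nra.
Qed.

(** [prox_exists] for the indicator function of the translate [K - x], whose
    epigraph is [(K - x) x [0, +oo[]. *)
Lemma projection_exists K x :
  K !=set0 ->
  (forall a b (s : R), K a -> K b -> 0 <= s <= 1 -> K (a + s *: (b - a))) ->
  (forall a, (forall e : R, 0 < e -> exists2 b, K b & dt (b - a) (b - a) <= e) -> K a) ->
  exists2 p, K p & forall q, K q -> dt (x - p) (q - p) <= 0.
Proof.
move=> [a Ka] Kconv Kclosed.
have [||||p [t [[Kp t0] pP]]] :=
  @prox_exists (fun q t => K (q + x) /\ 0 <= t) 0.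
- by exists (a - x), 0; rewrite subrK.
- by move=> q t [_ t0]; have := form_ge0 hf q; lra.
- move=> q t q' t' s [Kq t0] [Kq' t'0] s01; split; last by nra.
  rewrite addrAC (_ : q' - q = (q' + x) - (q + x)); first exact: Kconv.
  by rewrite opprD addrACA subrr addr0.
- move=> q t h; split.
    apply: Kclosed => e e0; have [q' [t' [[Kq' _] d _]]] := h e e0.
    by exists (q' + x) => //; rewrite opprD addrACA subrr addr0.
  apply/ler_addgt0Pr => e e0; have [q' [t' [[_ t'0] _]]] := h e e0.
  by rewrite ler_norml; lra.
exists (p + x) => // q Kq.
have := pP (q - x) 0; rewrite subrK => /(_ (conj Kq (lexx 0))).
have -> : x - (p + x) = - p by rewrite opprD addrCA subrr addr0.
by rewrite opprD (addrC (- p)) addrA formNl; lra.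
Qed.

(** The candidate [c] is the asymptotic center of [u], that is, the minimizer
    of [q |-> limsup |u k - q|^2].  It plays the part of a weak cluster point
    (it belongs to the closed convex hull of every tail of [u]) and is obtained
    without weak compactness. *)
Lemma tail_hull_nonempty u (M : R) :
  (forall k, dt (u k) (u k) <= M) ->
  exists c, forall v (d : R), 0 < d ->
    forall N, exists2 k, (N <= k)%N & dt v (u k - c) < d.
Proof.
move=> uM.
have [||||c [t0 [P0 cP]]] := @prox_exists
  (fun q t => forall e : R, 0 < e -> exists N, forall k, (N <= k)%N ->
     dt (u k) (u k) / 2 - dt (u k) q <= t + e) 0.
- exists 0, (M / 2) => e e0; exists 0%N => k _.
  by rewrite form0r; have := uM k; lra.
- move=> q t h; apply/ler_addgt0Pr => e e0; have [N /(_ N (leqnn N))] := h e e0.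
  by have := form_ge0 hf (u N - q); rewrite !formE (formC hf q); lra.
- move=> q t q' t' s h h' s01 e e0.
  have [N NP] := h e e0; have [N' NP'] := h' e e0.
  exists (maxn N N') => k; rewrite geq_max => /andP[Nk Nk'].
  have := NP k Nk; have := NP' k Nk'; rewrite !formE.
  move: (dt (u k) (u k)) (dt (u k) q') (dt (u k) q) => a b c; nra.
- move=> q t h e e0.
  have M0 : 0 <= M by apply: le_trans (uM 0%N); exact: form_ge0 hf _.
  pose d := e ^+ 2 / 9 / (1 + M).
  have d0 : 0 < d by rewrite !divr_gt0 ?exprn_gt0//; lra.
  have e3 : 0 < e / 3 by lra.
  have de : 0 < Num.min d (e / 3) by rewrite lt_min d0.
  have [q' [t' [P' qq tt]]] := h _ de.
  have [N NP] := P' _ e3; exists N => k Nk.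
  have := NP k Nk.
  move: tt; rewrite le_min => /andP[_]; rewrite ler_norml => /andP[t1 t2].
  have : `|dt (u k) (q' - q)| <= e / 3.
    rewrite -(@ler_pXn2r _ 2) ?nnegrE//; last by lra.
    rewrite real_normK ?num_real//; apply: le_trans (form_CS _ _) _.
    move: qq; rewrite le_min => /andP[qq _].
    have -> : (e / 3) ^+ 2 = (1 + M) * d by rewrite /d; field; lra.
    by apply: ler_pM => //; rewrite ?(form_ge0 hf)//; have := uM k; lra.
  by rewrite ler_norml formDr formNr; lra.
exists c => v d d0 N; apply: contrapT => h.
have hd k : (N <= k)%N -> d <= dt v (u k - c).
  by move=> Nk; rewrite leNgt; apply/negP => ?; apply: h; exists k.
(* if [dt v (u k - c)] stayed above [d], moving the center from [c] to [c + v]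
   would lower the upper limit by more than the subgradient at [c] allows *)
have := cP (c + v) (t0 - dt v c - d).
have -> : c + v - c = v by rewrite addrAC subrr add0r.
rewrite (formC hf c v) => h1.
suff : t0 - dt v c <= t0 - dt v c - d by lra.
apply: h1 => e e0; have [N' NP'] := P0 e e0.
exists (maxn N N') => k; rewrite geq_max => /andP[Nk Nk'].
by have := hd k Nk; have := NP' k Nk'; rewrite !formE (formC hf v (u k)); lra.
Qed.

(** Haugazeau's argument.  If the iterates stayed away from the projection
    [c] along some subsequence, expanding [|u k - x|^2 <= |c - x|^2] would keep
    that subsequence in the half-space [<x - c, q - c> >= e / 2], which
    then contains a point of [K], against the variational inequality of [c]. *)
Lemma haugazeau_cvg K x c u :
  (forall q, (forall v (d : R), 0 < d ->
     forall N, exists2 k, (N <= k)%N & dt v (u k - q) < d) -> K q) ->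
  (forall q, K q -> dt (x - c) (q - c) <= 0) ->
  (forall k, dt (u k - x) (u k - x) <= dt (c - x) (c - x)) ->
  forall e : R, 0 < e -> exists N, forall k, (N <= k)%N ->
    dt (u k - c) (u k - c) <= e.
Proof.
move=> Kclus cP ux e e0; apply: contrapT => h.
have /choice[f fP] (N : nat) : exists k, (N <= k)%N /\
    e < dt (u k - c) (u k - c).
  apply: contrapT => hN; apply: h; exists N => k Nk.
  by rewrite leNgt; apply/negP => ?; apply: hN; exists k.
have [q qP] : exists q, forall v (d : R), 0 < d ->
    forall N, exists2 k, (N <= k)%N & dt v (u (f k) - q) < d.
  apply: (@tail_hull_nonempty (fun k => u (f k)) (2 * dt x x + 2 * dt (c - x) (c - x))) => k.
  have := ux (f k); have := form_ge0 hf (u (f k) - x - x).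
  by rewrite !formE (formC hf x (u (f k))); lra.
have Kq : K q.
  apply: Kclus => v d d0 N; have [k Nk kd] := qP v d d0 N.
  by exists (f k) => //; exact: leq_trans Nk (fP k).1.
have e2 : 0 < e / 2 by lra.
have [k _] := qP (x - c) _ e2 0%N.
have := (fP k).2; have := ux (f k); have := cP q Kq.
rewrite !formE (formC hf (u (f k)) c) (formC hf (u (f k)) x) (formC hf x c).
by lra.
Qed.

End HilbertForm.

(** * Hilbert spaces and their products *)

Lemma innerC (R : realType) (V : hilbertType R) (x y : V) : '[x, y] = '[y, x].
Proof. by rewrite hermC expr0 mul1r. Qed.

(** Completeness of the norm, read through [<x, x> = |x|^2]. *)
Lemma inner_hilbert (R : realType) (V : hilbertType R) :
  hilbert_form (fun x y : V => '[x, y]).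
Proof.
split.
- exact: innerC.
- by move=> x y z; rewrite linearDl.
- by move=> a x y; rewrite linearZl_LR.
- by move=> x; rewrite inner_normE exprn_ge0.
move=> u ucauchy.
have cu : cvg (u @ \oo).
  apply/cauchy_cvgP/cauchyP => e /= e0.
  have [|N NP] := ucauchy ((e / 2) ^+ 2); first by rewrite exprn_gt0//; lra.
  exists (u N); exists N => // k /= Nk; rewrite -ball_normE /=.
  have := NP N k (leqnn N) Nk; rewrite inner_normE ler_pXn2r ?nnegrE//; lra.
exists (lim (u @ \oo)) => e e0.
have se : 0 < Num.sqrt e by rewrite sqrtr_gt0.
have /cvgrPdist_le/(_ _ se)[N _ NP] : u @ \oo --> lim (u @ \oo) by [].
exists N => k Nk; rewrite inner_normE -[leRHS]sqr_sqrtr ?(ltW e0)//.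
by rewrite ler_pXn2r ?nnegrE// ?(ltW se)// distrC; exact: NP.
Qed.

Lemma pair_hilbert (R : realType) (E1 E2 : lmodType R) dt1 dt2 :
  @hilbert_form R E1 dt1 -> @hilbert_form R E2 dt2 ->
  hilbert_form (fun x y : E1 * E2 => dt1 x.1 y.1 + dt2 x.2 y.2).
Proof.
move=> h1 h2; split=> [x y|x y z|a x y|x|u uc] /=.
- by rewrite (formC h1) (formC h2).
- by rewrite (formDl h1) (formDl h2) addrACA.
- by rewrite (formZl h1) (formZl h2) mulrDr.
- by rewrite addr_ge0 ?(form_ge0 h1)// (form_ge0 h2).
have [c1 c1P] : exists c, forall e : R, 0 < e -> exists N, forall k, (N <= k)%N ->
    dt1 ((u k).1 - c) ((u k).1 - c) <= e.
  apply: (form_complete h1) => e /uc[N NP]; exists N => k l Nk Nl.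
  by have := NP k l Nk Nl; have := form_ge0 h2 (u k - u l).2; rewrite /=; lra.
have [c2 c2P] : exists c, forall e : R, 0 < e -> exists N, forall k, (N <= k)%N ->
    dt2 ((u k).2 - c) ((u k).2 - c) <= e.
  apply: (form_complete h2) => e /uc[N NP]; exists N => k l Nk Nl.
  by have := NP k l Nk Nl; have := form_ge0 h1 (u k - u l).1; rewrite /=; lra.
exists (c1, c2) => e e0; have e2 : 0 < e / 2 by lra.
have [N1 N1P] := c1P _ e2; have [N2 N2P] := c2P _ e2.
exists (maxn N1 N2) => k; rewrite geq_max => /andP[Nk1 Nk2].
by have := N1P k Nk1; have := N2P k Nk2; rewrite /=; lra.
Qed.

(** * Minty's theorem *)

Section Minty.
Variables (R : realType) (V : hilbertType R).
Implicit Types (B : V -> set V) (x y u v a b : V).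
Let hV := @inner_hilbert R V.

(** Otherwise adding the pair [(x, u)] to the graph would extend [B]. *)
Lemma maximal_related B x u : maximal_monotone B ->
  (forall a b, B a b -> 0 <= '[x - a, u - b]) -> B x u.
Proof.
move=> [Bmon Bmax] xu.
apply: (Bmax (fun y => B y `|` [set w | y = x /\ w = u])).
- move=> y z v w [Byv|[-> ->]] [Bzw|[-> ->]].
  + exact: Bmon.
  + by rewrite -opprB -(opprB u) (formNl hV) (formNr hV) opprK; exact: xu.
  + exact: xu.
  + by rewrite subrr (formC hV) (form0r hV).
- by move=> y; exact: subsetUl.
- by right.
Qed.

(** The Fitzpatrick function of [B] is
    [q |-> sup {<q.1, b> + <a, q.2> - <a, b> | b in B a}]; it dominates
    [q |-> <q.1, q.2>] because [B] is maximal.  At the minimizer [(x, u)] of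
    this function plus [|q|^2 / 2], the optimality inequality tested on the
    graph of [B] reads [<a + u, b + x> >= |x + u|^2].  Hence [(- u, - x)] is
    monotonically related to [B], so it is in the graph, and testing the
    inequality there gives [u = - x]. *)
Lemma minty0 B : maximal_monotone B -> exists x, B x (- x).
Proof.
move=> Bmax; have Bmon := Bmax.1.
pose dt (p q : V * V) := '[p.1, q.1] + '[p.2, q.2].
have hP : hilbert_form dt := pair_hilbert hV hV.
pose P (q : V * V) (t : R) :=
  forall a b, B a b -> dt q (b, a) - '[a, b] <= t.
have PB a b : B a b -> P (a, b) '[a, b].
  move=> Bab c d Bcd; have := Bmon _ _ _ _ Bab Bcd.
  by rewrite /dt/= !(formE hV) (formC hV b c); lra.
have [a0 [b0 Bab0]] : exists a b, B a b.
  apply: contrapT => h; apply: (h); exists 0, 0; apply: maximal_related => // a b Bab.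
  by exfalso; apply: h; exists a, b.
have Pdom q t : P q t -> '[q.1, q.2] <= t.
  move=> Pqt; rewrite leNgt; apply/negP => h.
  suff : B q.1 q.2.
    by move=> /Pqt; rewrite /dt/= (formC hV q.2); lra.
  apply: maximal_related => // a b /Pqt.
  by rewrite /dt/= !(formE hV) (formC hV q.2 a); lra.
have [||||[x u] [t0 [P0 xuP]]] := @prox_exists _ _ dt hP P 0.
- by exists (a0, b0), '[a0, b0]; exact: PB.
- move=> q t /Pdom; have := form_ge0 hV (q.1 + q.2).
  by rewrite /dt !(formE hV) (formC hV q.2 q.1); lra.
- move=> q t q' t' s Pq Pq' s01 a b Bab.
  have := Pq _ _ Bab; have := Pq' _ _ Bab; rewrite !(formE hP).
  by move: (dt q (b, a)) (dt q' (b, a)) '[a, b] => r r' w; nra.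
- move=> q t h a b Bab; apply/ler_addgt0Pr => e e0.
  have e2 : 0 < e / 2 by lra.
  have [d d0 dP] := form_small hP (b, a) e2.
  have [|q' [t' [/(_ _ _ Bab) Pq' qq tt]]] := h (Num.min d (e / 2)).
    by rewrite lt_min d0.
  move: tt; rewrite le_min => /andP[_]; rewrite ler_norml => /andP[_ tt].
  move: qq; rewrite le_min => /andP[/dP + _]; rewrite ler_norml => /andP[+ _].
  by rewrite !(formE hP) !(formC hP (b, a)); lra.
have key a b : B a b -> '[x + u, x + u] <= '[a + u, b + x].
  move=> /PB/xuP; have := Pdom _ _ P0.
  rewrite /dt/= !(formE hV) (formC hV a x) (formC hV u x).
  by lra.
have Bux : B (- u) (- x).
  apply: maximal_related => // a b /key; have := form_ge0 hV (x + u).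
  by rewrite -!opprD (formNl hV) (formNr hV) opprK (addrC a) (addrC b); lra.
have := key _ _ Bux; rewrite !addNr (form0r hV) inner_normE => h.
have /eqP : x + u = 0.
  by apply/eqP; rewrite -normr_eq0 -sqrf_eq0 eq_le h exprn_ge0.
rewrite addr_eq0 => /eqP xu; exists x.
by move: Bux; rewrite -xu.
Qed.

(** Reduction to [minty0] for the operator with graph
    [{(x, lam b - v) | b in B x}]. *)
Lemma minty B (lam : R) v : maximal_monotone B -> 0 < lam ->
  exists x b, B x b /\ x + lam *: b = v.
Proof.
move=> Bmax lam0; have Bmon := Bmax.1.
have lamN0 : lam != 0 by rewrite gt_eqF.
pose B' x := [set u | B x (lam^-1 *: (u + v))].
have sub2 (u w : V) : lam^-1 *: (u + v) - lam^-1 *: (w + v) = lam^-1 *: (u - w).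
  by rewrite -scalerBr opprD addrACA subrr addr0.
have [|x B'x] := @minty0 B'.
  split.
    move=> x y u w B'x B'y; have := Bmon _ _ _ _ B'x B'y.
    by rewrite sub2 (formZr hV) pmulr_rge0// invr_gt0.
  move=> A Amon BA x u Axu.
  suff : B x (lam^-1 *: (u + v)) by [].
  apply: maximal_related => // a b Bab.
  have Aab : A a (lam *: b - v).
    by apply: BA; rewrite /B'/= subrK scalerA mulVf// scale1r.
  have bE : b = lam^-1 *: ((lam *: b - v) + v).
    by rewrite subrK scalerA mulVf// scale1r.
  rewrite bE sub2 (formZr hV) mulr_ge0// ?invr_ge0 ?(ltW lam0)//.
  exact: Amon.
exists x, (lam^-1 *: (- x + v)); split => //.
by rewrite scalerA mulfV// scale1r addrA subrr add0r.
Qed.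

End Minty.

(** * Resolvents of the perturbed operators *)

Section Resolvent.
Variables (R : realType) (V : hilbertType R).
Implicit Types (B : V -> set V) (F : V -> V) (C D : set V) (x y u v a b : V).
Let hV := @inner_hilbert R V.

Lemma cauchy_schwarz x y : '[x, y] <= `|x| * `|y|.
Proof.
rewrite (le_trans (ler_norm _))// -(@ler_pXn2r _ 2) ?nnegrE ?mulr_ge0//.
rewrite real_normK ?num_real// exprMn -!inner_normE.
exact: form_CS hV x y.
Qed.

Lemma cocoercive_lipschitz (L : R) D F x y : 0 < L -> cocoercive L D F ->
  D x -> D y -> `|F x - F y| <= L * `|x - y|.
Proof.
move=> L0 Fcc Dx Dy; have := Fcc x y Dx Dy.
rewrite ler_pdivrMl// => /le_trans/(_ (ler_wpM2l (ltW L0) (cauchy_schwarz _ _))).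
move: (`|F x - F y|) (`|x - y|) (normr_ge0 (F x - F y)) (normr_ge0 (x - y)) => r s r0 s0.
have [->|r1] := eqVneq r 0; first by rewrite mulr_ge0// ltW.
rewrite mulrCA expr2 ler_pM2l// lt_neqAle eq_sym r1//.
Qed.

(** The points solving [a + lam (F + B) a = v] are the fixed points of
    [x |-> (I + lam B)^-1 (v - lam F x)], a contraction of [C] for
    [lam = 1 / (2 L)], since the resolvent of [B] is nonexpansive. *)
Lemma sum_resolvent (L : R) B C D F v : maximal_monotone B -> 0 < L ->
  closed C -> C !=set0 -> opdom B `<=` C -> C `<=` D -> cocoercive L D F ->
  exists a b, opadd (single D F) B a b /\ a + (2 * L)^-1 *: b = v.
Proof.
move=> Bmax L0 Ccl Cn0 BC CD Fcc; set lam := (2 * L)^-1.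
have lam0 : 0 < lam by rewrite invr_gt0; lra.
have /choice[J JP] w : exists x, exists b, B x b /\ x + lam *: b = w.
  exact: minty.
have J1 w w' : `|J w - J w'| <= `|w - w'|.
  have [b [Bb bE]] := JP w; have [b' [Bb' bE']] := JP w'.
  have : `|J w - J w'| ^+ 2 <= `|J w - J w'| * `|w - w'|.
    apply: le_trans _ (cauchy_schwarz _ _).
    have h := Bmax.1 _ _ _ _ Bb Bb'.
    have -> : w - w' = (J w - J w') + lam *: (b - b').
      by rewrite -{1}bE -{1}bE' opprD addrACA -scalerBr.
    rewrite (formDr hV) (formZr hV).
    by rewrite inner_normE lerDl mulr_ge0// ltW.
  rewrite expr2; have [->|r0] := eqVneq `|J w - J w'| 0; first by [].
  by rewrite ler_pM2l// lt_neqAle eq_sym r0/=.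
pose f x := J (v - lam *: F x).
have fC x : C (f x) by apply: BC; have [b [Bb _]] := JP (v - lam *: F x); exists b.
have fCC : set_fun C C f by move=> x _; exact: fC.
have [|||a _ aE] := @banach_fixed_point R V C (mkfun_fun fCC) => //.
  exists (2^-1)%:nng; split; first by rewrite /=; lra.
  move=> [x y] /= [Cx Cy]; apply: le_trans (J1 _ _) _.
  rewrite opprD addrACA subrr add0r -opprD normrN -scalerBr normrZ gtr0_norm//.
  rewrite ler_pdivrMl; last by lra.
  apply: le_trans (cocoercive_lipschitz L0 Fcc (CD _ Cx) (CD _ Cy)) _.
  by rewrite /=; lra.
have [b [Bb bE]] := JP (v - lam *: F a).
have Ja : J (v - lam *: F a) = a by [].
exists a, (F a + b); split.
  exists (F a); first by split=> //; apply: CD; rewrite -Ja; exact: fC.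
  by exists b => //; rewrite -Ja.
by rewrite scalerDr -{1}Ja addrCA bE addrC subrK.
Qed.

End Resolvent.

(** * The product space and its separating functions *)

Lemma big_option (R : zmodType) (T : finType) (f : option T -> R) :
  \sum_i f i = \sum_j f (Some j) + f None.
Proof.
rewrite (bigD1 None)//= addrC; congr (_ + _).
rewrite (reindex_omap Some id); last by case.
by apply: eq_bigl => j; rewrite eqxx.
Qed.

Lemma sum_uniform (R : realType) (T : finType) (f : T -> R) (e : R) :
  (forall i, f i <= e) -> \sum_i f i <= #|T|%:R * e.
Proof.
move=> fe; apply: (le_trans (ler_sum _ (fun i _ => fe i))).
by rewrite sumr_const mulr_natl.
Qed.

Lemma opnorm_bound (R : realType) (V W : hilbertType R) (f : {linear V -> W}) x :
  bounded_near f (nbhs (0 : V)) -> `|f x| <= opnorm f * `|x|.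
Proof.
move=> /linear_boundedP[M [_ fM]].
have ub : has_ubound [set `|f x| | x in [set x : V | `|x| <= 1]].
  exists (`|M| + 1) => _ [y y1 <-].
  have M1 : M < `|M| + 1 by rewrite ltr_pwDr// ler_norm.
  by apply: le_trans (fM _ M1 y) _; rewrite ler_piMr// addr_ge0.
have [->|x0] := eqVneq x 0; first by rewrite linear0 !normr0 mulr0.
have nx : 0 < `|x| by rewrite normr_gt0.
rewrite -ler_pdivrMr// mulrC -[X in X * _]gtr0_norm ?invr_gt0//.
rewrite -normrZ -linearZ; apply: ub_le_sup ub _ _; exists (`|x|^-1 *: x) => //=.
by rewrite normrZ gtr0_norm ?invr_gt0// mulVf// gt_eqF.
Qed.

Section Extended.
Variables (R : realType) (n : nat).
Variables (H0 : hilbertType R) (H : 'I_n.-1 -> hilbertType R).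
Notation idx := (option 'I_n.-1).
Notation hs := (hsp H0 H).
Notation ext := (ext H0 H).
Implicit Types (p q : ext) (i : idx) (j : 'I_n.-1).

Lemma gdot_zpart (g : R) p : g * `|zpart p| ^+ 2 <= gdot g p p.
Proof.
rewrite /gdot inner_normE lerDl; apply: sumr_ge0 => j _.
exact: form_ge0 (inner_hilbert _) _.
Qed.

Lemma gdot_wpart (g : R) p j : 0 <= g -> `|wpart p j| ^+ 2 <= gdot g p p.
Proof.
move=> g0; rewrite /gdot (bigD1 j)//= inner_normE addrCA inner_normE lerDl.
rewrite addr_ge0 ?mulr_ge0// ?exprn_ge0//; apply: sumr_ge0 => j' _.
exact: form_ge0 (inner_hilbert _) _.
Qed.

Lemma gdot_hilbert (g : R) : 0 < g -> hilbert_form (@gdot R n H0 H g).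
Proof.
move=> g0; have hf (V : hilbertType R) := @inner_hilbert R V.
split.
- move=> p q; rewrite /gdot (formC (hf _)); congr (_ + _).
  by apply: eq_bigr => j _; exact: formC (hf _) _ _.
- move=> p q r; rewrite /gdot (formDl (hf _)) mulrDr addrACA -big_split.
  by congr (_ + _); apply: eq_bigr => j _; exact: formDl (hf _) _ _ _.
- move=> a p q; rewrite /gdot (formZl (hf _)) mulrDr mulr_sumr mulrCA.
  by congr (_ + _); apply: eq_bigr => j _; exact: formZl (hf _) _ _ _.
- move=> p; rewrite /gdot addr_ge0 ?mulr_ge0 ?(ltW g0)// ?(form_ge0 (hf _))//.
  by apply: sumr_ge0 => j _; exact: form_ge0 (hf _) _.
move=> u uc.
have [z zP] : exists z, forall e : R, 0 < e -> exists N, forall k, (N <= k)%N ->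
    '[zpart (u k) - z, zpart (u k) - z] <= e.
  apply: (form_complete (hf H0)) => e e0.
  have [N NP] := uc _ (mulr_gt0 g0 e0); exists N => k l Nk Nl.
  rewrite -(ler_pM2l g0) inner_normE.
  exact: le_trans (gdot_zpart g (u k - u l)) (NP k l Nk Nl).
have wP j : exists w, forall e : R, 0 < e -> exists N, forall k, (N <= k)%N ->
    '[wpart (u k) j - w, wpart (u k) j - w] <= e.
  apply: (form_complete (hf (H j))) => e e0.
  have [N NP] := uc _ e0; exists N => k l Nk Nl; rewrite inner_normE.
  exact: le_trans (gdot_wpart (u k - u l) j (ltW g0)) (NP k l Nk Nl).
exists (Ext z (fun j => projT1 (cid (wP j)))) => e e0.
have e1 : 0 < e / (2 * g) by rewrite divr_gt0// mulr_gt0.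
have e2 : 0 < e / 2 / n.-1.+1%:R by rewrite !divr_gt0.
have [N0 N0P] := zP _ e1.
have /choice[Nj NjP] j : exists N, forall k, (N <= k)%N ->
    '[wpart (u k) j - projT1 (cid (wP j)), wpart (u k) j - projT1 (cid (wP j))] <=
    e / 2 / n.-1.+1%:R.
  by case: (cid (wP j)) => /= w /(_ _ e2).
exists (maxn N0 (\max_j Nj j)) => k; rewrite geq_max => /andP[Nk0 Nkj].
rewrite /gdot (splitr e) lerD//.
  have := N0P k Nk0; rewrite ler_pdivlMr ?mulr_gt0//= => h.
  by rewrite ler_pdivlMr//; lra.
apply: (le_trans (sum_uniform (e := e / 2 / n.-1.+1%:R) _)).
  by move=> j; apply: NjP; apply: leq_trans Nkj; exact: leq_bigmax.
rewrite card_ord mulrCA ler_piMr//; first by lra.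
by rewrite ler_pdivrMr// mul1r ler_nat.
Qed.

Unset Implicit Arguments.
Variables (G : forall i : idx, {linear H0 -> hs i}) (Gadj : forall i : idx, hs i -> H0).
Set Implicit Arguments.
Hypothesis G_adjoint : forall i z u, '[G i z, u] = '[z, Gadj i u].
Hypothesis G_last : forall z, G None z = z.
Let hV (V : hilbertType R) := @inner_hilbert R V.

Lemma inner_injr (V : hilbertType R) (u v : V) : (forall z, '[z, u] = '[z, v]) -> u = v.
Proof.
move=> h; apply/eqP; rewrite -subr_eq0 -normr_eq0 -sqrf_eq0 -inner_normE.
by rewrite (formDr (hV _)) (formNr (hV _)) h subrr.
Qed.

Lemma GadjD i u v : Gadj i (u + v) = Gadj i u + Gadj i v.
Proof.
by apply: inner_injr => z; rewrite (formDr (hV _)) -!G_adjoint (formDr (hV _)).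
Qed.

Lemma GadjZ i (a : R) u : Gadj i (a *: u) = a *: Gadj i u.
Proof.
by apply: inner_injr => z; rewrite (formZr (hV _)) -!G_adjoint (formZr (hV _)).
Qed.

Lemma GadjB i u v : Gadj i (u - v) = Gadj i u - Gadj i v.
Proof. by rewrite -scaleN1r GadjD GadjZ scaleN1r. Qed.

Lemma Gadj_last u : Gadj None u = u.
Proof. by apply: inner_injr => z; rewrite -G_adjoint G_last. Qed.

Lemma inner_sumr (V : hilbertType R) (I : finType) (z : V) (f : I -> V) :
  '[z, \sum_i f i] = \sum_i '[z, f i].
Proof. by rewrite linear_sumr. Qed.

Lemma sum_Gadj_wfull p : \sum_i Gadj i (wfull Gadj p i) = 0.
Proof. by rewrite big_option /= Gadj_last subrr. Qed.

Lemma sum_inner_G z (b : forall i, hs i) :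
  \sum_i '[G i z, b i] = '[z, \sum_i Gadj i (b i)].
Proof. by rewrite inner_sumr; apply: eq_bigr => i _; exact: G_adjoint. Qed.

(** The sum of the monotonicity products of [(G_i z, w_i)] against the pairs
    [(a_i, b_i)], with the opposite sign, so that it is nonpositive on the
    extended solutions.  The function [phi_k] of the algorithm is the separator
    of [(x_k, y_k)] minus the sum of the errors. *)
Definition separator (a b : forall i, hs i) p : R :=
  \sum_i '[G i (zpart p) - a i, b i - wfull Gadj p i].

(** The gradient of the separator for the product [gdot g]. *)
Definition sepgrad (g : R) (a b : forall i, hs i) : ext :=
  Ext (g^-1 *: \sum_i Gadj i (b i)) (fun j => a (Some j) - G (Some j) (a None)).

(** The quadratic part [- \sum_i <G_i z, w_i>] of the separator vanishes
    because [\sum_i G_i^* w_i = 0] on the extended space. *)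
Lemma separatorE (g : R) a b p : 0 < g ->
  separator a b p = gdot g (sepgrad g a b) p - \sum_i '[a i, b i].
Proof.
move=> g0; rewrite /separator /gdot/=.
have -> : \sum_i '[G i (zpart p) - a i, b i - wfull Gadj p i] =
    \sum_i '[G i (zpart p), b i] - \sum_i '[G i (zpart p), wfull Gadj p i] -
    \sum_i '[a i, b i] + \sum_i '[a i, wfull Gadj p i].
  rewrite -!sumrB -big_split/=; apply: eq_bigr => i _.
  by rewrite !(formE (hV _)); lra.
rewrite !sum_inner_G sum_Gadj_wfull (form0r (hV _)) subr0.
rewrite (formZl (hV _)) mulrA mulfV ?gt_eqF// mul1r (formC (hV _)) addrAC.
congr (_ + _ + _); rewrite big_option /= (formNr (hV _)) inner_sumr -sumrB.
by apply: eq_bigr => j _; rewrite (formDl (hV _)) (formNl (hV _)) -(@G_adjoint (Some j)).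
Qed.

Lemma sepgrad_norm (g : R) a b : 0 < g ->
  gdot g (sepgrad g a b) (sepgrad g a b) =
  g^-1 * `|\sum_i Gadj i (b i)| ^+ 2 +
  \sum_j `|a (Some j) - G (Some j) (a None)| ^+ 2.
Proof.
move=> g0; rewrite /gdot/= (formZl (hV _)) (formZr (hV _)) inner_normE.
rewrite mulVKf ?gt_eqF//; congr (_ + _).
by apply: eq_bigr => j _; rewrite inner_normE.
Qed.

End Extended.

(** * Inertial steps of a Haugazeau sequence *)

Section Inertial.
Variables (R : realType) (E : lmodType R) (dt : E -> E -> R).
Hypothesis hf : hilbert_form dt.
Variables (u : nat -> E) (al be : nat -> R) (a b D : R).
Hypothesis u_acute : forall k, dt (u 0 - u k) (u k.+1 - u k) <= 0.
Hypothesis u_bounded : forall k, dt (u k - u 0) (u k - u 0) <= D.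
Hypothesis al_ge0 : forall k, 0 <= al k.
Hypothesis be_ge0 : forall k, 0 <= be k.
Hypothesis al_le : forall k, al k <= a.
Hypothesis be_le : forall k, be k <= b.

Let r k := dt (u k - u 0%N) (u k - u 0%N).

Definition extrapolation k :=
  let v := u k + al k *: (u k - u k.-1) in v + be k *: (v - u 0%N).

Definition inertial_gap k := extrapolation k - u k.+1.

(** Acuteness says that [u k] is the projection of [u 0] onto a half-space
    containing [u k.+1]; this is Pythagoras' inequality for it. *)
Lemma increment_le k :
  dt (u k.+1 - u k) (u k.+1 - u k) <= r k.+1 - r k.
Proof.
have := u_acute k; rewrite /r.
have -> : u k.+1 - u 0 = (u k.+1 - u k) + (u k - u 0) by rewrite addrA subrK.
rewrite -(opprB (u k) (u 0)) (formNl hf).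
move: (u k.+1 - u k) (u k - u 0) => d q.
by rewrite !(formE hf) (formC hf q d); lra.
Qed.

Lemma backward_increment_le k :
  dt (u k - u k.-1) (u k - u k.-1) <= r k - r k.-1.
Proof.
by case: k => [|k]; rewrite ?subrr ?(form0r hf)//; exact: increment_le.
Qed.

(** With [e], [q], [d] the last increment, the displacement from the start and
    the next increment, the gap is [al (1 + be) e + be q - d].  Acuteness
    gives [<q, d> >= 0], which drops one cross term; Young's inequality treats
    the other two. *)
Lemma inertial_gap_le k (A := a * (1 + b)) :
  dt (inertial_gap k) (inertial_gap k) <=
  A * (2 + A + b) * (r k - r k.-1) + (1 + A) * (r k.+1 - r k) +
  (1 + a) * D * be k ^+ 2.
Proof.
have := u_acute k; rewrite -(opprB (u k) (u 0%N)) (formNl hf).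
have := u_bounded k; have := increment_le k; have := backward_increment_le k.
have := al_ge0 k; have := be_ge0 k; have := al_le k; have := be_le k.
have -> : inertial_gap k = (al k * (1 + be k)) *: (u k - u k.-1) +
    be k *: (u k - u 0%N) - (u k.+1 - u k).
  rewrite /inertial_gap /extrapolation; move: (u k - u k.-1) => e.
  rewrite (addrAC _ _ (- u 0%N)) scalerDr scalerA mulrDr mulr1 scalerDl (mulrC (be k)).
  by rewrite opprB !addrA [X in X - _](AC 4 (2*4*3*1)).
move: (u k - u k.-1) (u k - u 0%N) (u k.+1 - u k) (r k - r k.-1) (r k.+1 - r k).
move=> e q d re rd; move: (al k) (be k) => al' be' beb ala be0 al0 he hd hq hqd.
have ee0 := form_ge0 hf e; have dd0 := form_ge0 hf d; have qq0 := form_ge0 hf q.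
have h1 := form_ge0 hf (e + d).
have h2 := form_ge0 hf ((1 + be') *: e - be' *: q).
move: h1 h2; rewrite !(formE hf) (formC hf d e) (formC hf q e) (formC hf d q).
rewrite (formC hf q d) in hqd *.
move: (dt e e) (dt q q) (dt d d) (dt e q) (dt e d) (dt d q) ee0 dd0 qq0 he hd hq hqd.
move=> ee qq dd eq ed dq ee0 dd0 qq0 he hd hq hqd h1 h2.
have a0 : 0 <= a by lra.
have b0 : 0 <= b by lra.
pose A' := al' * (1 + be').
have A'0 : 0 <= A' by rewrite mulr_ge0//; lra.
have A'A : A' <= A by apply: ler_pM => //; lra.
have step : A' * (1 + A') * ee + al' * (1 + be') ^+ 2 * ee + (1 + A') * dd +
    (1 + al') * be' ^+ 2 * qq <=
    A * (2 + A + b) * re + (1 + A) * rd + (1 + a) * D * be' ^+ 2.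
  have -> : A * (2 + A + b) * re = A * (1 + A) * re + A * (1 + b) * re by lra.
  have -> : al' * (1 + be') ^+ 2 = A' * (1 + be') by rewrite /A'; lra.
  have b1 : 0 <= 1 + be' by lra.
  rewrite !lerD//.
  - by rewrite !ler_pM ?mulr_ge0//; lra.
  - by rewrite !ler_pM ?mulr_ge0//; lra.
  - by rewrite !ler_pM//; lra.
  - rewrite [leRHS]mulrAC; apply: ler_pM => //.
      by rewrite mulr_ge0 ?exprn_ge0//; lra.
    by rewrite ler_wpM2r ?exprn_ge0//; lra.
apply: le_trans step.
have g1 := mulr_ge0 A'0 h1.
have g2 := mulr_ge0 al0 h2.
have g3 : 0 <= be' * dq by rewrite mulr_ge0//; lra.
rewrite /A' in g1 *; lra.
Qed.

(** The increments telescope, and [r] stays below [D]. *)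
Lemma inertial_gap_sum k (A := a * (1 + b)) :
  \sum_(l < k) dt (inertial_gap l) (inertial_gap l) <=
  ((1 + A) ^+ 2 + A * (1 + b)) * D + (1 + a) * D * \sum_(l < k) be l ^+ 2.
Proof.
have a0 : 0 <= a := le_trans (al_ge0 0%N) (al_le 0%N).
have b0 : 0 <= b := le_trans (be_ge0 0%N) (be_le 0%N).
have A0 : 0 <= A by rewrite mulr_ge0//; lra.
suff : \sum_(l < k) dt (inertial_gap l) (inertial_gap l) <=
    A * (2 + A + b) * r k.-1 + (1 + A) * r k + (1 + a) * D * \sum_(l < k) be l ^+ 2.
  move=> /le_trans; apply; rewrite lerD2r.
  have -> : ((1 + A) ^+ 2 + A * (1 + b)) * D = A * (2 + A + b) * D + (1 + A) * D.
    by lra.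
  by rewrite lerD// ler_wpM2l ?u_bounded ?mulr_ge0//; lra.
elim: k => [|k IH].
  by rewrite !big_ord0 /r subrr (form0r hf) !mulr0 !addr0.
rewrite !big_ord_recr /=; apply: le_trans (lerD IH (inertial_gap_le k)) _.
rewrite -/A; move: (r k.-1) (r k) (r k.+1) (be k ^+ 2) (\sum_(_ < _) _) => r1 r2 r3 s1 s2.
by lra.
Qed.

End Inertial.

(** * Cocoercive perturbations and projections *)

Section Operators.
Variables (R : realType) (V : hilbertType R).
Implicit Types (F : V -> V) (C D : set V) (x y z : V).
Let hV := @inner_hilbert R V.

Lemma convex_set_segment C : convex_set C ->
  forall a b (s : R), C a -> C b -> 0 <= s <= 1 -> C (a + s *: (b - a)).
Proof.
move=> Cc a b s Ca Cb /andP[s0 s1].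
have := Cc b a (Itv01 s0 s1) (mem_set Cb) (mem_set Ca).
rewrite inE => h.
have -> : a + s *: (b - a) = s *: b + (1 - s) *: a.
  by rewrite scalerBr scalerBl scale1r addrCA.
exact: h.
Qed.

(** The projection [p] of [z] makes an obtuse angle with every [x] of [C]. *)
Lemma projection_closer C z p x : convex_set C ->
  nearest (fun u v : V => `|u - v|) C z p -> C x -> `|x - p| <= `|x - z|.
Proof.
move=> Cc [Cp pmin] Cx.
have h : '[z - p, x - p] <= 0.
  apply: (nearest_variational hV (convex_set_segment Cc)) => // q Cq.
  by rewrite !inner_normE ler_pXn2r ?nnegrE// pmin.
rewrite -(@ler_pXn2r _ 2) ?nnegrE// -!inner_normE.
have -> : x - z = (x - p) - (z - p) by rewrite opprB addrA subrK.
have := form_ge0 hV (z - p).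
move: (x - p) (z - p) h => a b; rewrite (formC hV b a) => h b0.
by rewrite !(formE hV) (formC hV b a); lra.
Qed.

(** With [f = F z - F y], split [x - y = (x - z) + (z - y)]: cocoercivity
    gives [<z - y, f> >= |f|^2 / L], and Young's inequality with weight [L / 2]
    absorbs [<x - z, f>] at the price of [L |x - z|^2 / 4]. *)
Lemma cocoercive_enlargement (L : R) D F x z y : 0 < L -> cocoercive L D F ->
  D y -> D z -> - (L * `|x - z| ^+ 2 / 4) <= '[x - y, F z - F y].
Proof.
move=> L0 Fcc Dy Dz; have := Fcc z y Dz Dy; rewrite (formC hV).
have -> : x - y = (x - z) + (z - y) by rewrite addrA subrK.
have LV : 0 < L^-1 by rewrite invr_gt0.
have s0 : 0 < L / 2 by rewrite divr_gt0.
have := form_young hV (- (x - z)) (F z - F y) s0.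
move: (F z - F y) (x - z) (z - y) => f a b.
rewrite (formDl hV) !(formNl hV) (formNr hV) opprK invf_div !inner_normE.
by move: '[a, f] '[b, f] (`|a| ^+ 2) (`|f| ^+ 2) L^-1 => r s t t' l; lra.
Qed.

End Operators.

Lemma monotone_opadd (R : realType) (V : hilbertType R) (A B : V -> set V) :
  monotone_op A -> monotone_op B -> monotone_op (opadd A B).
Proof.
move=> Am Bm x y _ _ [u Au [v Bv <-]] [u' Au' [v' Bv' <-]].
rewrite opprD addrACA (formDr (inner_hilbert V)).
by apply: addr_ge0; [exact: Am|exact: Bm].
Qed.

(** Expand the square and use [2 <v_i, v_j> <= |v_i|^2 + |v_j|^2]. *)
Lemma norm_sum_sq (R : realType) (V : hilbertType R) (I : finType) (v : I -> V) :
  `|\sum_i v i| ^+ 2 <= #|I|%:R * \sum_i `|v i| ^+ 2.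
Proof.
have hV := inner_hilbert V.
pose S := \sum_i `|v i| ^+ 2.
have e i : \sum_j (`|v i| ^+ 2 + `|v j| ^+ 2) / 2 =
    (#|I|%:R * `|v i| ^+ 2 + S) / 2.
  by rewrite -mulr_suml big_split/= sumr_const -[_ *+ #|_|]mulr_natl.
have -> : #|I|%:R * \sum_i `|v i| ^+ 2 =
    \sum_i \sum_j (`|v i| ^+ 2 + `|v j| ^+ 2) / 2.
  rewrite (eq_bigr _ (fun i _ => e i)) -mulr_suml big_split/= -mulr_sumr.
  by rewrite sumr_const -[_ *+ #|_|]mulr_natl -/S; lra.
rewrite -inner_normE inner_sumr; apply: ler_sum => i _.
rewrite (formC hV) inner_sumr; apply: ler_sum => j _.
have := form_ge0 hV (v i - v j).
by rewrite !(formE hV) (formC hV (v j)) -!inner_normE; lra.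
Qed.

(** * The extended-solution set *)

Section Algorithm.
Variables (R : realType) (n : nat).
Variables (H0 : hilbertType R) (H : 'I_n.-1 -> hilbertType R).
Notation idx := (option 'I_n.-1).
Notation hs := (hsp H0 H).
Notation ext := (ext H0 H).
Unset Implicit Arguments.
Variables (domF C : forall i : idx, set (hs i)) (F : forall i : idx, hs i -> hs i).
Variables (B : forall i : idx, hs i -> set (hs i)).
Variables (G : forall i : idx, {linear H0 -> hs i}) (Gadj : forall i : idx, hs i -> H0).
Variable L : idx -> R.
Hypothesis F_monotone : forall i, monotone_op (single (domF i) (F i)).
Hypothesis B_maximal : forall i, maximal_monotone (B i).
Hypothesis domB_C : forall i, opdom (B i) `<=` C i.
Hypothesis C_domF : forall i, C i `<=` domF i.
Hypothesis C_nonempty : forall i, C i !=set0.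
Hypothesis C_closed : forall i, closed (C i).
Hypothesis C_convex : forall i, convex_set (C i).
Hypothesis G_bounded : forall i, bounded_near (G i) (nbhs (0 : H0)).
Hypothesis G_adjoint : forall i z u, '[G i z, u] = '[z, Gadj i u].
Hypothesis G_last : forall z, G None z = z.
Hypothesis L_gt0 : forall i, 0 < L i.
Hypothesis F_cocoercive : forall i, cocoercive (L i) (domF i) (F i).
Variables (sigma g : R).
Hypothesis sigma_gt0 : 0 < sigma.
Hypothesis sigma_lt1 : sigma < 1.
Hypothesis g_gt0 : 0 < g.
Set Implicit Arguments.

Let hV (V : hilbertType R) := @inner_hilbert R V.
Let hE := @gdot_hilbert R n H0 H g g_gt0.
Notation Se := (ext_solutions domF F B G Gadj).
Notation sep := (separator G Gadj).
Implicit Types (p q : ext) (i : idx) (j : 'I_n.-1).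

Lemma ext_solutionsP p :
  Se p <-> forall i, Top domF F B (G i (zpart p)) (wfull Gadj p i).
Proof.
split=> [[hj hn] [j|]|h]; first exact: hj.
- by rewrite G_last.
- by split=> [j|]; [exact: (h (Some j))|have := h None; rewrite G_last].
Qed.

(** The reverse implication is the maximality of the product of the [T_i] in
    the form of Minty: the test pair [(a_i, b_i)] is chosen with
    [a_i + lam_i b_i = G_i z + lam_i w_i], so that the separator is
    [\sum_i lam_i |w_i - b_i|^2]. *)
Lemma ext_solutions_separator p :
  Se p <-> forall a b : forall i, hs i,
    (forall i, Top domF F B (a i) (b i)) -> sep a b p <= 0.
Proof.
rewrite ext_solutionsP; split=> [Sp a b Tab|h].
  rewrite -oppr_ge0 -sumrN; apply: sumr_ge0 => i _.
  rewrite -(formNr (hV _)) opprB.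
  have := Sp i; have := Tab i.
  move=> Ta Tw; exact: (monotone_opadd (F_monotone i) (B_maximal i).1 Tw Ta).
pose lam i := (2 * L i)^-1.
have lam0 i : 0 < lam i by rewrite invr_gt0 mulr_gt0.
have ex i : exists ab : hs i * hs i, Top domF F B ab.1 ab.2 /\
    ab.1 + lam i *: ab.2 = G i (zpart p) + lam i *: wfull Gadj p i.
  have [a [b [Tab abE]]] := sum_resolvent (G i (zpart p) + lam i *: wfull Gadj p i)
    (B_maximal i) (L_gt0 i) (C_closed i) (C_nonempty i) (domB_C i) (C_domF i)
    (F_cocoercive i).
  by exists (a, b).
pose ab i := projT1 (cid (ex i)).
have abP i : Top domF F B (ab i).1 (ab i).2 /\
    (ab i).1 + lam i *: (ab i).2 = G i (zpart p) + lam i *: wfull Gadj p i.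
  exact: projT2 (cid (ex i)).
have diff i : G i (zpart p) - (ab i).1 = lam i *: ((ab i).2 - wfull Gadj p i).
  apply/eqP; rewrite scalerBr subr_eq addrAC (addrC (lam i *: _)).
  by rewrite (abP i).2 addrK.
have := h _ _ (fun i => (abP i).1).
rewrite /separator (eq_bigr (fun i => lam i * `|(ab i).2 - wfull Gadj p i| ^+ 2)); last first.
  by move=> i _; rewrite diff (formZl (hV _)) inner_normE.
move=> sum_le0 i.
have /eqP : \sum_i lam i * `|(ab i).2 - wfull Gadj p i| ^+ 2 = 0.
  apply/eqP; rewrite eq_le sum_le0 sumr_ge0// => i' _.
  by rewrite mulr_ge0 ?exprn_ge0// ltW.
rewrite psumr_eq0; last by move=> i' _; rewrite mulr_ge0 ?exprn_ge0// ltW.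
move=> /allP/(_ i (mem_index_enum _)); rewrite /= mulf_eq0 gt_eqF//= sqrf_eq0 normr_eq0.
rewrite subr_eq0 => /eqP bw; have := diff i; rewrite -bw subrr scaler0 => /eqP.
by rewrite subr_eq0 => /eqP ->; exact: (abP i).1.
Qed.

(** Convexity and closedness of [S_e] follow from those of half-spaces. *)
Lemma ext_solutions_segment p q (s : R) :
  Se p -> Se q -> 0 <= s <= 1 -> Se (p + s *: (q - p)).
Proof.
rewrite !ext_solutions_separator => hp hq s01 a b Tab.
have := hp a b Tab; have := hq a b Tab.
rewrite !(separatorE G_adjoint G_last _ _ _ g_gt0) !(formE hE).
by move: (gdot _ _ _) (gdot _ _ _) (\sum_i _) => r r' t; nra.
Qed.

Lemma ext_solutions_closed p :
  (forall e : R, 0 < e -> exists2 q, Se q & gdot g (q - p) (q - p) <= e) -> Se p.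
Proof.
move=> h; apply/ext_solutions_separator => a b Tab.
apply/ler_addgt0Pr => e e0.
have [d d0 dP] := form_small hE (sepgrad G Gadj g a b) e0.
have [q /ext_solutions_separator/(_ _ _ Tab) Sq /dP] := h d d0.
move: Sq; rewrite !(separatorE G_adjoint G_last _ _ _ g_gt0) !(formE hE) ler_norml.
by lra.
Qed.

Lemma ext_solutions_nonempty :
  (exists z, solution domF F B G Gadj z) -> Se !=set0.
Proof.
move=> [z [u Tu uE]]; exists (Ext z (fun j => u (Some j))); apply/ext_solutionsP.
case=> [j|] /=; first exact: Tu.
move: uE; rewrite big_option (Gadj_last G_adjoint G_last) => /eqP.
by rewrite addrC addr_eq0 => /eqP <-; exact: (Tu None).
Qed.

Lemma ext_solution_solution p : Se p -> solution domF F B G Gadj (zpart p).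
Proof.
move=> /ext_solutionsP Sp; exists (wfull Gadj p) => //.
exact: sum_Gadj_wfull.
Qed.

Lemma ext_solutions_projection x :
  (exists z, solution domF F B G Gadj z) ->
  exists2 p, Se p & forall q, Se q -> gdot g (x - p) (q - p) <= 0.
Proof.
move=> /ext_solutions_nonempty S0.
apply: (projection_exists hE) => //; last exact: ext_solutions_closed.
exact: ext_solutions_segment.
Qed.

(** * One step of the algorithm *)

Variables (alpha beta : nat -> R) (p : nat -> ext).
Unset Implicit Arguments.
Variables (zb x y : nat -> forall i : idx, hs i).
Set Implicit Arguments.
Hypothesis alg : algorithm2 C F B G Gadj L sigma g alpha beta p zb x y.

Notation pt := (ptilde alpha beta p).
Notation lam := (stepsize L sigma).
Notation eps := (epsk L zb x).

Definition xgap k i : hs i := G i (zpart (pt k)) - x k i.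

(** The quantity to which all residuals of one step are compared. *)
Definition merit k : R := \sum_i (lam i)^-1 * `|xgap k i| ^+ 2.

Notation grad k := (sepgrad G Gadj g (x k) (y k)).

Lemma stepsize_gt0 i : 0 < lam i.
Proof. by rewrite divr_gt0// mulr_gt0// exprn_gt0. Qed.

Lemma merit_ge0 k : 0 <= merit k.
Proof.
apply: sumr_ge0 => i _.
by rewrite mulr_ge0 ?exprn_ge0// invr_ge0 ltW// stepsize_gt0.
Qed.

Lemma y_wfull k i : y k i - wfull Gadj (pt k) i = (lam i)^-1 *: xgap k i.
Proof.
have l0 : lam i != 0 by rewrite gt_eqF// stepsize_gt0.
by rewrite (alg_y alg) addrAC scalerDr scalerA mulVf// scale1r addrK.
Qed.

Lemma y_split k i : exists2 b, B i (x k i) b & y k i = F i (zb k i) + b.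
Proof.
have l0 : lam i != 0 by rewrite gt_eqF// stepsize_gt0.
have [b Bb bE] := alg_x alg k i; exists b => //.
rewrite (alg_y alg); apply: (scalerI l0).
rewrite scalerA mulfV// scale1r scalerDr; apply/eqP.
by rewrite subr_eq -addrA bE addrC subrK.
Qed.

Lemma x_in_C k i : C i (x k i).
Proof. by have [b Bb _] := y_split k i; apply: domB_C; exists b. Qed.

Lemma zb_in_C k i : C i (zb k i).
Proof. by case: (alg_zbar alg k i). Qed.

(** [x_i] is in [C_i], so [|x_i - zb_i| <= |x_i - G_i z~|] for the projection
    [zb_i]; the step size turns [L_i / 4] into [sigma^2 / (2 lam_i)]. *)
Lemma eps_le k i : eps k i <= sigma ^+ 2 / 2 * ((lam i)^-1 * `|xgap k i| ^+ 2).
Proof.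
have h : `|x k i - zb k i| <= `|xgap k i|.
  rewrite /xgap (distrC (G i _)).
  exact: projection_closer (C_convex i) (alg_zbar alg k i) (x_in_C k i).
rewrite /epsk /stepsize invf_div.
have -> : sigma ^+ 2 / 2 * (L i / (2 * sigma ^+ 2) * `|xgap k i| ^+ 2) =
  L i * `|xgap k i| ^+ 2 / 4 by field; rewrite gt_eqF.
by rewrite ler_pM2r// ler_pM2l// ler_pXn2r ?nnegrE.
Qed.

Lemma sum_eps_le k : \sum_i eps k i <= sigma ^+ 2 / 2 * merit k.
Proof. by rewrite mulr_sumr; apply: ler_sum => i _; exact: eps_le. Qed.

Lemma F_enlarged k i : enlargement (single (domF i) (F i)) (eps k i) (x k i) (F i (zb k i)).
Proof.
move=> a _ [Da ->].
exact: cocoercive_enlargement (L_gt0 i) (F_cocoercive i) Da (C_domF i _ (zb_in_C k i)).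
Qed.

Lemma y_enlarged k i a b : Top domF F B a b -> - eps k i <= '[x k i - a, y k i - b].
Proof.
move=> [u Fu [v Bv <-]]; have [w Bw ->] := y_split k i.
rewrite opprD addrACA (formDr (hV _)) -[leLHS]addr0 lerD//.
  exact: (F_enlarged k Fu).
exact: (B_maximal i).1.
Qed.

Lemma phik_separator k q :
  phik G Gadj L zb x y k q = sep (x k) (y k) q - \sum_i eps k i.
Proof. by rewrite /phik sumrB. Qed.

Lemma phikE k q : phik G Gadj L zb x y k q =
  gdot g (grad k) q - \sum_i '[x k i, y k i] - \sum_i eps k i.
Proof. by rewrite phik_separator (separatorE G_adjoint G_last _ _ _ g_gt0). Qed.

Lemma solution_in_Hk k q : Se q -> Hk G Gadj L zb x y k q.
Proof.
move=> /ext_solutionsP Sq; rewrite /Hk/= /phik -oppr_ge0 -sumrN.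
apply: sumr_ge0 => i _; rewrite opprB subr_ge0 -lerN2.
apply: le_trans (y_enlarged k (Sq i)) _.
by rewrite -(formNl (hV _)) opprB.
Qed.

(** [H_k] and [W_k] are half-spaces. *)
Lemma HkWk_segment k q q' (s : R) : (Hk G Gadj L zb x y k `&` Wk g p k) q ->
  (Hk G Gadj L zb x y k `&` Wk g p k) q' -> 0 <= s <= 1 ->
  (Hk G Gadj L zb x y k `&` Wk g p k) (q + s *: (q' - q)).
Proof.
rewrite /Hk /Wk /= !phikE => -[h1 w1] [h2 w2] s01.
split.
  move: h1 h2; rewrite !(formE hE).
  by move: (gdot _ _ _) (gdot _ _ _) (\sum_i _) (\sum_i _) => r r' t t'; nra.
move: w1 w2; move: (p 0%N - p k) => v; rewrite !(formE hE).
by move: (gdot g v q) (gdot g v q') (gdot g v (p k)) => r r' t; nra.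
Qed.

Lemma next_variational k q : (Hk G Gadj L zb x y k `&` Wk g p k) q ->
  gdot g (p 0%N - p k.+1) (q - p k.+1) <= 0.
Proof.
have [Kp pmin] := alg_next alg k.
apply: (nearest_variational hE (@HkWk_segment k)) => // q' /pmin.
by rewrite /gdist /gnorm ler_sqrt// (form_ge0 hE).
Qed.

(** By induction, [S_e] is included in [H_k] and [W_k], and the variational
    inequality of the projection onto their intersection is membership in
    the next [W_k]. *)
Lemma solution_in_Wk k q : Se q -> Wk g p k q.
Proof.
move=> Sq; elim: k => [|k IH].
  by rewrite /Wk/= subrr (formC hE) (form0r hE).
by apply: next_variational; split; [exact: solution_in_Hk|].
Qed.

Lemma p_acute k : gdot g (p 0%N - p k) (p k.+1 - p k) <= 0.
Proof. by have [[_ +] _] := alg_next alg k. Qed.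

(** Membership of [q] in [W_k] makes [|p k - p 0| <= |q - p 0|]. *)
Lemma p_bounded k q : Se q ->
  gdot g (p k - p 0%N) (p k - p 0%N) <= gdot g (q - p 0%N) (q - p 0%N).
Proof.
move=> /(solution_in_Wk k); rewrite /Wk/=.
have -> : q - p 0%N = (q - p k) - (p 0%N - p k) by rewrite opprB addrA subrK.
rewrite -(opprB (p 0%N)) (formNl hE) (formNr hE) opprK.
have := form_ge0 hE (q - p k).
move: (q - p k) (p 0%N - p k) => a b a0; rewrite !(formE hE) (formC hE a b).
by lra.
Qed.

(** * Quantitative estimates *)

Local Notation M := (Num.max (Lmax L / (2 * sigma ^+ 2)) (2 * sigma ^+ 2 / Lmin L)).
Local Notation gap k := (inertial_gap p alpha beta k).

Let twos2 : 0 < 2 * sigma ^+ 2.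
Proof. by rewrite mulr_gt0// exprn_gt0. Qed.

Lemma stepsizeV_le i : (lam i)^-1 <= M.
Proof.
rewrite le_max invf_div ler_pM2r ?invr_gt0//.
by rewrite /Lmax le_bigmax.
Qed.

Lemma stepsize_le i : lam i <= M.
Proof.
rewrite le_max /stepsize ler_pM2l// lef_pV2 ?posrE//; last first.
  by rewrite /Lmin; apply: lt_bigmin => // j _.
by rewrite /Lmin bigmin_le orbT.
Qed.

Lemma Gmax2_ge1 : 1 <= Gmax2 G.
Proof. exact: bigmax_ge_id. Qed.

Lemma G_norm2_le i z : `|G i z| ^+ 2 <= Gmax2 G * `|z| ^+ 2.
Proof.
have o2 : opnorm (G i) ^+ 2 <= Gmax2 G by exact: le_bigmax.
apply: le_trans (ler_wpM2r (exprn_ge0 2 (normr_ge0 z)) o2).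
by rewrite -exprMn ler_pXn2r ?nnegrE ?opnorm_bound//
  (le_trans (normr_ge0 _) (opnorm_bound z (G_bounded i))).
Qed.

Lemma Gadj_norm2_le i u : `|Gadj i u| ^+ 2 <= Gmax2 G * `|u| ^+ 2.
Proof.
set v := Gadj i u.
have h : `|v| ^+ 2 <= `|G i v| * `|u|.
  by rewrite -inner_normE -G_adjoint; exact: cauchy_schwarz.
have [->|v0] := eqVneq v 0.
  by rewrite normr0 expr0n mulr_ge0 ?exprn_ge0// (le_trans ler01 Gmax2_ge1).
have v2 : 0 < `|v| ^+ 2 by rewrite exprn_gt0// normr_gt0.
rewrite -(ler_pM2l v2).
apply: le_trans (_ : (`|G i v| * `|u|) ^+ 2 <= _).
  by rewrite -expr2 ler_pXn2r ?nnegrE ?mulr_ge0.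
have := ler_wpM2r (exprn_ge0 2 (normr_ge0 u)) (G_norm2_le i v).
by rewrite exprMn; lra.
Qed.

Lemma residual_sum k : residual Gadj y k = \sum_i Gadj i (y k i).
Proof. by rewrite big_option (Gadj_last G_adjoint G_last). Qed.

(** The exact vectors [wfull] at the extrapolated point have zero residual, so
    only the differences [y - wfull] contribute. *)
Lemma residualE k : residual Gadj y k = \sum_i Gadj i ((lam i)^-1 *: xgap k i).
Proof.
have w0 := sum_Gadj_wfull G_adjoint G_last (pt k).
transitivity (\sum_i Gadj i (y k i) - \sum_i Gadj i (wfull Gadj (pt k) i)).
  by rewrite w0 subr0 residual_sum.
by rewrite -sumrB; apply: eq_bigr => i _; rewrite -(GadjB G_adjoint) y_wfull.
Qed.

Hypothesis n_ge2 : (2 <= n)%N.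

Local Notation K := (n%:R * Gmax2 G * M).
Local Notation mx := (Num.max 1 g^-1).

Lemma card_idx : #|{: idx}| = n.
Proof. by rewrite card_option card_ord prednK// (leq_trans _ n_ge2). Qed.

Lemma residual_le k : `|residual Gadj y k| ^+ 2 <= K * merit k.
Proof.
rewrite residualE; apply: le_trans (norm_sum_sq _) _.
set m := M; rewrite card_idx -!mulrA ler_wpM2l// /merit !mulr_sumr; apply: ler_sum => i _.
apply: le_trans (Gadj_norm2_le _) _; rewrite ler_wpM2l ?(le_trans ler01 Gmax2_ge1)//.
have l0 : 0 <= (lam i)^-1 by rewrite invr_ge0 ltW// stepsize_gt0.
rewrite normrZ ger0_norm// exprMn expr2 -mulrA ler_wpM2r ?stepsizeV_le//.
by rewrite mulr_ge0// exprn_ge0.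
Qed.

(** [x_j - G_j x_n = G_j (z~ - x_n) - (G_j z~ - x_j)]. *)
Lemma xdiff_le k :
  \sum_j `|x k (Some j) - G (Some j) (x k None)| ^+ 2 <= 2 * K * merit k.
Proof.
have G0 := le_trans ler01 Gmax2_ge1; have G1 := Gmax2_ge1.
have sq (V : hilbertType R) (a b : V) : `|a - b| ^+ 2 <= 2 * `|a| ^+ 2 + 2 * `|b| ^+ 2.
  rewrite -!inner_normE; have := form_ge0 (hV V) (a + b).
  by rewrite !(formE (hV _)) (formC (hV _) b a); lra.
have s0 i : 0 <= `|xgap k i| ^+ 2 by rewrite exprn_ge0.
apply: (@le_trans _ _ (2 * (n%:R * Gmax2 G * \sum_i `|xgap k i| ^+ 2))).
  rewrite big_option.
  apply: (@le_trans _ _ (\sum_j (2 * `|xgap k (Some j)| ^+ 2 +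
     2 * (Gmax2 G * `|xgap k None| ^+ 2)))).
    apply: ler_sum => j _.
    have -> : x k (Some j) - G (Some j) (x k None) =
        G (Some j) (xgap k None) - xgap k (Some j).
      by rewrite /xgap G_last linearB opprB [RHS]addrC addrA subrK.
    apply: le_trans (sq _ _ _) _; rewrite addrC lerD2l ler_pM2l//.
    exact: G_norm2_le.
  rewrite big_split/= -mulr_sumr sumr_const card_ord -[_ *+ n.-1]mulr_natl.
  have n1 : 1 <= n%:R :> R by rewrite ler1n (leq_trans _ n_ge2).
  have nn : n.-1%:R <= n%:R :> R by rewrite ler_nat leq_pred.
  have n0 : 0 <= n.-1%:R :> R by [].
  have := sumr_ge0 _ (fun j (_ : true) => s0 (Some j)) : 0 <= \sum_j _.
  move: (\sum_j _) (`|xgap k None| ^+ 2) (s0 None) (Gmax2 G) G0 G1 => S r r0 Gm G0 G1.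
  move: n1 nn n0.
  move: n%:R n.-1%:R => a b a1 ba b0 S0.
  have h1 : S <= a * Gm * S by rewrite ler_peMl//; nra.
  have h2 : b * (Gm * r) <= a * (Gm * r) by rewrite ler_wpM2r// mulr_ge0.
  lra.
set m := M; rewrite -!mulrA ler_pM2l// ler_wpM2l// ler_wpM2l// /merit mulr_sumr.
apply: ler_sum => i _.
rewrite mulrCA -[leLHS](mulKf (lt0r_neq0 (stepsize_gt0 i))).
rewrite ler_wpM2l ?invr_ge0 ?(ltW (stepsize_gt0 i))//.
by rewrite ler_wpM2r ?stepsize_le.
Qed.

Lemma K_ge0 : 0 <= K.
Proof.
rewrite !mulr_ge0 ?(le_trans ler01 Gmax2_ge1)//.
by apply: le_trans (stepsize_le None); rewrite ltW// stepsize_gt0.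
Qed.

Lemma grad_norm_le k : gdot g (grad k) (grad k) <= 3 * mx * K * merit k.
Proof.
rewrite (sepgrad_norm _ _ _ _ g_gt0) -residual_sum.
have h1 := residual_le k; have h2 := xdiff_le k.
have gV : 0 < g^-1 by rewrite invr_gt0.
have m1 : 1 <= mx by rewrite le_max lexx.
have mg : g^-1 <= mx by rewrite le_max lexx orbT.
have KS : 0 <= K * merit k by rewrite mulr_ge0 ?K_ge0 ?merit_ge0.
apply: le_trans (lerD (ler_wpM2l (ltW gV) h1) h2) _.
move: mx m1 mg (K) (merit k) KS => m m1 mg K' S KS.
have e1 : g^-1 * (K' * S) <= m * (K' * S) by rewrite ler_wpM2r.
have e2 : 1 * (K' * S) <= m * (K' * S) by rewrite ler_wpM2r.
lra.
Qed.

(** At the extrapolated point [phi_k] is the merit minus the errors, which are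
    at most [sigma^2 / 2] of it; at the next iterate [phi_k <= 0].  The
    difference of the two values is the product of gradient and gap. *)
Lemma merit_le_gap k :
  (1 - sigma ^+ 2) * merit k <= gdot g (grad k) (gap k).
Proof.
have h1 : phik G Gadj L zb x y k (pt k) = merit k - \sum_i eps k i.
  rewrite /phik sumrB; congr (_ - _); apply: eq_bigr => i _.
  by rewrite y_wfull (formZr (hV _)) inner_normE.
have h2 : phik G Gadj L zb x y k (p k.+1) <= 0.
  by have [[+ _] _] := alg_next alg k.
have := sum_eps_le k; have := merit_ge0 k.
have -> : gap k = pt k - p k.+1 by [].
move: h1 h2; rewrite !phikE (formDr hE (grad k) (pt k)) (formNr hE).
have s2 : 0 <= sigma ^+ 2 by rewrite exprn_ge0// ltW.
move: (gdot g (grad k) (pt k)) (gdot g (grad k) (p k.+1)) (merit k) => r r' S.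
move: (\sum_i '[x k i, y k i]) (\sum_i eps k i) => e f.
move=> h1 h2 S0 fS; have : 0 <= sigma ^+ 2 * S by rewrite mulr_ge0.
by lra.
Qed.

(** With [S] the merit, [N] the squared norm of the gradient and [D] that of
    the gap, [(t S)^2 <= N D] by Cauchy-Schwarz and [N <= A S], so one factor
    [S] cancels. *)
Lemma merit_grad_le k (A := 3 * mx * K) (t := 1 - sigma ^+ 2) :
  t ^+ 2 * merit k <= A * gdot g (gap k) (gap k) /\
  t ^+ 2 * gdot g (grad k) (grad k) <= A ^+ 2 * gdot g (gap k) (gap k).
Proof.
have A0 : 0 <= A.
  by rewrite mulr_ge0 ?K_ge0// mulr_ge0// le_max ler01.
have t0 : 0 < t by rewrite subr_gt0 expr_lt1// ltW.
have h1 := merit_le_gap k; have h2 := grad_norm_le k.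
have h3 := form_CS hE (grad k) (gap k); have S0 := merit_ge0 k.
have D0 := form_ge0 hE (gap k).
rewrite -/A in h2; rewrite -/t in h1.
move: (gdot _ (grad k) (gap k)) (gdot _ (gap k) (gap k)) (gdot _ (grad k) (grad k)) (merit k)
   h1 h2 h3 S0 D0 => r D N S h1 h2 h3 S0 D0.
have key : t ^+ 2 * S <= A * D.
  have [->|Sn0] := eqVneq S 0; first by rewrite mulr0 mulr_ge0.
  have Sp : 0 < S by rewrite lt_neqAle eq_sym Sn0.
  rewrite -(ler_pM2l Sp).
  apply: (@le_trans _ _ (r ^+ 2)).
    have -> : S * (t ^+ 2 * S) = (t * S) ^+ 2 by ring.
    have tS : 0 <= t * S by rewrite mulr_ge0// ltW.
    by rewrite ler_pXn2r ?nnegrE// (le_trans tS).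
  apply: le_trans h3 _.
  have -> : S * (A * D) = A * S * D by ring.
  by rewrite ler_wpM2r.
split => //; apply: le_trans (ler_wpM2l (exprn_ge0 2 (ltW t0)) h2) _.
have -> : t ^+ 2 * (A * S) = A * (t ^+ 2 * S) by ring.
by rewrite (expr2 A) -mulrA ler_wpM2l.
Qed.

(** * Iteration complexity *)

Hypothesis alpha_bounded : has_ubound (range alpha).
Hypothesis beta_summable : cvgn (series (fun k => beta k ^+ 2)).

Local Notation abar := (sup (range alpha)).
Local Notation bbar := (sup (range beta)).
Local Notation sbar := (limn (series (fun k => beta k ^+ 2))).
Local Notation Om := (Omega alpha beta).

Lemma beta_sum_le k : \sum_(l < k) beta l ^+ 2 <= sbar.
Proof.
have := nondecreasing_cvgn_le _ beta_summable k; rewrite /series/= big_mkord; apply.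
by apply: nondecreasing_series => l _ _; exact: sqr_ge0.
Qed.

Lemma beta_bounded : has_ubound (range beta).
Proof.
exists (1 + sbar) => _ [k _ <-].
have := beta_sum_le k.+1; rewrite big_ord_recr /=.
have : 0 <= \sum_(l < k) beta l ^+ 2 by apply: sumr_ge0 => l _; exact: sqr_ge0.
by have := sqr_ge0 (beta k); have := sqr_ge0 (beta k - 1); rewrite sqrrB expr1n; lra.
Qed.

Lemma alpha_le k : alpha k <= abar.
Proof. by apply: ub_le_sup => //; exists k. Qed.

Lemma beta_le k : beta k <= bbar.
Proof. by apply: ub_le_sup; [exact: beta_bounded|exists k]. Qed.

(** The bound of [inertial_gap_sum] exceeds [Omega D] by at most [a (1 + b) D],
    hence the factor [5 / 4]. *)
Lemma gap_sum_le k q : Se q ->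
  \sum_(l < k) gdot g (gap l) (gap l) <=
  5 / 4 * Om * gdot g (q - p 0%N) (q - p 0%N).
Proof.
move=> Sq; set D := gdot g (q - _) _.
have D0 : 0 <= D := form_ge0 hE _.
have a0 : 0 <= abar := le_trans (alg_alpha_ge0 alg 0%N) (alpha_le 0%N).
have b0 : 0 <= bbar := le_trans (alg_beta_ge0 alg 0%N) (beta_le 0%N).
apply: le_trans (inertial_gap_sum hE p_acute (fun k => p_bounded k Sq)
  (alg_alpha_ge0 alg) (alg_beta_ge0 alg) alpha_le beta_le k) _.
have s0 := beta_sum_le k; have sb0 : 0 <= sbar.
  by apply: le_trans s0; apply: sumr_ge0 => l _; exact: sqr_ge0.
rewrite /Omega -/D.
have aD : 0 <= (1 + abar) * D by rewrite mulr_ge0//; lra.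
apply: le_trans (lerD (lexx _) (ler_wpM2l aD s0)) _.
move: abar bbar sbar a0 b0 sb0 {aD s0} => a b s a0 b0 s0.
have [A AE] : exists A, A = a * (1 + b) by exists (a * (1 + b)).
have A0 : 0 <= A by rewrite AE mulr_ge0//; lra.
rewrite -AE.
have -> : (1 + A) ^+ 2 + A * (1 + b) = (1 + a) * (1 + b) * (1 + A) + A - b.
  by rewrite AE; lra.
have -> : ((1 + a) * (1 + b) * (1 + A) + A - b) * D + (1 + a) * D * s =
   ((1 + a) * ((1 + b) * (1 + A) + s) + A - b) * D by lra.
rewrite ler_wpM2r//.
(* the excess [A] is absorbed by [4 A <= (1 + A) ^+ 2 <= Omega] *)
have e1 : 1 + A <= (1 + a) * (1 + b) by rewrite AE; nra.
have e2 : (1 + A) * (1 + A) <= (1 + a) * (1 + b) * (1 + A).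
  by rewrite ler_wpM2r//; lra.
have e3 : 0 <= (1 + a) * s by rewrite mulr_ge0//; lra.
have := sqr_ge0 (1 - A); rewrite expr2.
by lra.
Qed.

(** The least term is below the average. *)
Lemma exists_small_term (f : nat -> R) k :
  exists2 l, (l <= k)%N & k.+1%:R * f l <= \sum_(l < k.+1) f l.
Proof.
have [l _ lP] := @Order.TotalTheory.arg_minP _ _ _ (@ord0 k) xpredT (fun l : 'I_k.+1 => f l) isT.
exists l; first exact: leq_ord l.
rewrite mulr_natl -[X in _ *+ X](card_ord k.+1) -sumr_const.
by apply: ler_sum => l' _; exact: lP.
Qed.

Lemma d0E q : Se q -> (forall q', Se q' -> gdot g (p 0%N - q) (q' - q) <= 0) ->
  (forall q', Se q' -> gdist g (p 0%N) q <= gdist g (p 0%N) q') /\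
  d0 domF F B G Gadj g (p 0%N) = gdist g (p 0%N) q.
Proof.
move=> Sq qP.
have qmin q' : Se q' -> gdist g (p 0%N) q <= gdist g (p 0%N) q'.
  move=> /qP; rewrite /gdist /gnorm ler_sqrt ?(form_ge0 hE)//.
  have -> : p 0%N - q' = (p 0%N - q) - (q' - q) by rewrite opprB addrA subrK.
  have := form_ge0 hE (q' - q); move: (p 0%N - q) (q' - q) => v w w0.
  by rewrite !(formE hE) (formC hE w v); lra.
split => //; apply/eqP; rewrite eq_le; apply/andP; split.
  by apply: ge_inf; [exists 0 => _ [q' _ <-]; exact: sqrtr_ge0|exists q].
by apply: lb_le_inf; [exists (gdist g (p 0%N) q), q|move=> _ [q' Sq' <-]; exact: qmin].
Qed.

(** At the index [l] of the smallest gap, [merit_grad_le] applies.  The factors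
    [3] of the gradient bound and [5 / 4] of the gap bound fit in the stated
    constants: [3^2 * 5/4 <= 4^2] for the residuals, and
    [1/2 * 3 * 5/4 <= 4] for the errors. *)
Lemma complexity k q : Se q -> (forall q', Se q' -> gdot g (p 0%N - q) (q' - q) <= 0) ->
  let dist := d0 domF F B G Gadj g (p 0%N) in
  exists2 l : nat, (l <= k)%N &
     [/\ forall i, opadd (enlargement (single (domF i) (F i)) (eps l i))
           (B i) (x l i) (y l i),
         `|residual Gadj y l| <=
           K * dist / Num.sqrt k.+1%:R *
           (4 * Num.sqrt g * mx * Num.sqrt Om / (1 - sigma ^+ 2)),
         forall j, `|x l (Some j) - G (Some j) (x l None)| <=
           K * dist / Num.sqrt k.+1%:R *
           (4 * mx * Num.sqrt Om / (1 - sigma ^+ 2))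
       & \sum_i eps l i <=
           K * dist ^+ 2 / k.+1%:R *
           (4 * sigma ^+ 2 * mx * Om / (1 - sigma ^+ 2) ^+ 2)].
Proof.
move=> Sq /(d0E Sq)[_ dE] dist.
have dist0 : 0 <= dist by rewrite /dist dE sqrtr_ge0.
have dist2 : gdot g (q - p 0%N) (q - p 0%N) = dist ^+ 2.
  rewrite /dist dE sqr_sqrtr ?(form_ge0 hE)// -opprB.
  by rewrite (formNl hE) (formNr hE) opprK.
have [l lk lP] := exists_small_term (fun l => gdot g (gap l) (gap l)) k.
exists l => //.
set t := 1 - sigma ^+ 2.
have t0 : 0 < t by rewrite subr_gt0 expr_lt1// ltW.
have k0 : 0 < k.+1%:R :> R by [].
have m1 : 1 <= mx by rewrite le_max lexx.
have K0 := K_ge0.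
have gapl : gdot g (gap l) (gap l) <= 5 / 4 * Om * dist ^+ 2 / k.+1%:R.
  by rewrite ler_pdivlMr// mulrC -dist2; exact: le_trans lP (gap_sum_le _ Sq).
have Om0 : 0 <= Om.
  have a0 : 0 <= abar := le_trans (alg_alpha_ge0 alg 0%N) (alpha_le 0%N).
  have b0 : 0 <= bbar := le_trans (alg_beta_ge0 alg 0%N) (beta_le 0%N).
  have s0 : 0 <= sbar by have := beta_sum_le 0; rewrite big_ord0.
  have ab0 : 0 <= abar * (1 + bbar) by rewrite mulr_ge0//; lra.
  by rewrite /Omega mulr_ge0 ?addr_ge0// mulr_ge0// addr_ge0.
have OmD0 : 0 <= Om * dist ^+ 2 / k.+1%:R.
  by apply: divr_ge0 => //; apply: mulr_ge0 => //; exact: exprn_ge0.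
have [h1 h2] := merit_grad_le l; rewrite -/t in h1 h2.
have [Q QE] : exists Q, Q = K * dist / Num.sqrt k.+1%:R * (4 * mx * Num.sqrt Om / t).
  by eexists.
have Q0 : 0 <= Q.
  rewrite QE; have m0 : 0 <= mx := le_trans ler01 m1.
  apply: mulr_ge0; apply: divr_ge0 => //; last exact: ltW.
    exact: mulr_ge0.
  by rewrite !mulr_ge0.
have grad_le : gdot g (grad l) (grad l) <= Q ^+ 2.
  have -> : Q ^+ 2 = 16 * mx ^+ 2 * K ^+ 2 * (Om * dist ^+ 2 / k.+1%:R) / t ^+ 2.
    rewrite QE !exprMn !exprVn !sqr_sqrtr ?(ltW k0)//.
    by field; rewrite !gt_eqF.
  rewrite ler_pdivlMr ?exprn_gt0// mulrC; apply: le_trans h2 _.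
  have c0 : 0 <= (3 * mx * K) ^+ 2 by exact: sqr_ge0.
  apply: le_trans (ler_wpM2l c0 gapl) _.
  move: OmD0.
  have -> : 5 / 4 * Om * dist ^+ 2 / k.+1%:R = 5 / 4 * (Om * dist ^+ 2 / k.+1%:R).
    by rewrite !mulrA.
  move: (_ / k.+1%:R) => W W0.
  have : 0 <= (mx * K) ^+ 2 * W by rewrite mulr_ge0// sqr_ge0.
  by rewrite !exprMn; lra.
have gradE := sepgrad_norm G Gadj (x l) (y l) g_gt0.
rewrite -residual_sum in gradE.
have gV : 0 < g^-1 by rewrite invr_gt0.
have r0 : 0 <= g^-1 * `|residual Gadj y l| ^+ 2.
  by rewrite mulr_ge0 ?exprn_ge0// ltW.
have x0 : 0 <= \sum_j `|x l (Some j) - G (Some j) (x l None)| ^+ 2.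
  by apply: sumr_ge0 => j _; exact: exprn_ge0.
split.
- move=> i; have [b Bb ->] := y_split l i.
  by exists (F i (zb l i)); [exact: F_enlarged|exists b].
- have -> : K * dist / Num.sqrt k.+1%:R * (4 * Num.sqrt g * mx * Num.sqrt Om / t) =
      Num.sqrt g * Q.
    by rewrite QE; ring.
  rewrite -(@ler_pXn2r _ 2) ?nnegrE ?mulr_ge0 ?sqrtr_ge0//.
  rewrite exprMn sqr_sqrtr ?(ltW g_gt0)// -ler_pdivrMl//.
  by apply: le_trans grad_le; rewrite gradE lerDl.
- move=> j; rewrite -QE -(@ler_pXn2r _ 2) ?nnegrE//.
  apply: le_trans grad_le; rewrite gradE (bigD1 j)//= addrCA lerDl addr_ge0//.
  by apply: sumr_ge0 => j' _; exact: exprn_ge0.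
- apply: le_trans (sum_eps_le l) _.
  have t2 : 0 < t ^+ 2 by rewrite exprn_gt0.
  have -> : K * dist ^+ 2 / k.+1%:R * (4 * sigma ^+ 2 * mx * Om / t ^+ 2) =
      sigma ^+ 2 / 2 * (8 * mx * K * (Om * dist ^+ 2 / k.+1%:R) / t ^+ 2).
    by field; rewrite !gt_eqF.
  rewrite ler_wpM2l ?divr_ge0 ?exprn_ge0 ?(ltW sigma_gt0)//.
  rewrite ler_pdivlMr// mulrC; apply: le_trans h1 _.
  have c0 : 0 <= 3 * mx * K by apply: mulr_ge0 => //; apply: mulr_ge0 => //; exact: le_trans m1.
  apply: le_trans (ler_wpM2l c0 gapl) _.
  move: OmD0.
  have -> : 5 / 4 * Om * dist ^+ 2 / k.+1%:R = 5 / 4 * (Om * dist ^+ 2 / k.+1%:R).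
    by rewrite !mulrA.
  move: (_ / k.+1%:R) => W W0.
  have : 0 <= mx * K * W.
    by apply: mulr_ge0 => //; apply: mulr_ge0 => //; exact: le_trans m1.
  by lra.
Qed.

(** * Strong convergence *)

Lemma wfullB q q' i : wfull Gadj (q - q') i = wfull Gadj q i - wfull Gadj q' i.
Proof.
case: i => [j|] //=.
rewrite opprK addrC -opprB -sumrB; congr (- _).
by apply: eq_bigr => j _; exact: (GadjB G_adjoint).
Qed.

Lemma wfull_bound i : exists c, forall q, `|wfull Gadj q i| ^+ 2 <= c * gdot g q q.
Proof.
case: i => [j|]; first by exists 1 => q; rewrite mul1r gdot_wpart// ltW.
exists (#|'I_n.-1|%:R * (#|'I_n.-1|%:R * Gmax2 G)) => q /=; rewrite normrN.
apply: le_trans (norm_sum_sq _) _; rewrite -!mulrA ler_wpM2l//.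
apply: sum_uniform => j; apply: le_trans (Gadj_norm2_le _) _.
by rewrite ler_wpM2l ?(le_trans ler01 Gmax2_ge1)// gdot_wpart// ltW.
Qed.

Lemma Gz_bound i q : `|G i (zpart q)| ^+ 2 <= Gmax2 G / g * gdot g q q.
Proof.
apply: le_trans (G_norm2_le _ _) _.
rewrite -mulrA ler_wpM2l ?(le_trans ler01 Gmax2_ge1)// ler_pdivlMl//.
exact: gdot_zpart.
Qed.

Lemma norm2_cvg (V : hilbertType R) (u : nat -> V) v :
  (fun k => `|u k - v| ^+ 2) @ \oo --> 0 -> u @ \oo --> v.
Proof.
move=> u0; apply/cvgrPdist_le => e e0.
have /cvgrPdist_le/(_ _ (exprn_gt0 2 e0)) := u0; apply: filterS => k.
rewrite sub0r normrN ger0_norm ?exprn_ge0// distrC.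
by rewrite ler_pXn2r ?nnegrE// ltW.
Qed.

Lemma squeeze0 (f h : nat -> R) : (forall k, 0 <= f k) -> (forall k, f k <= h k) ->
  h @ \oo --> 0 -> f @ \oo --> 0.
Proof.
move=> f0 fh; apply: (squeeze_cvgr (f := fun=> 0)); last exact: cvg_cst.
by apply: nearW => k; rewrite f0 fh.
Qed.

Lemma cvg0_scale (c : R) (f : nat -> R) : f @ \oo --> 0 -> (fun k => c * f k) @ \oo --> 0.
Proof. by move=> /(cvgM (cvg_cst c)); rewrite mulr0; exact. Qed.

Lemma bounded_sum_cvg0 (f : nat -> R) (m : R) : (forall k, 0 <= f k) ->
  (forall k, \sum_(l < k) f l <= m) -> f @ \oo --> 0.
Proof.
move=> f0 fm; apply: cvg_series_cvg_0; apply: nondecreasing_is_cvgn.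
  by apply: nondecreasing_series => l _ _; exact: f0.
by exists m => _ [k _ <-]; rewrite /series/= big_mkord.
Qed.

Lemma cvg0_eventually (f : nat -> R) (e : R) : f @ \oo --> 0 -> 0 < e ->
  exists N, forall k, (N <= k)%N -> f k <= e.
Proof.
move=> /cvgrPdist_le f0 /f0[N _ NP]; exists N => k /NP.
by rewrite /= sub0r normrN; exact: le_trans (ler_norm _).
Qed.

Lemma gap_cvg0 q : Se q -> (fun k => gdot g (gap k) (gap k)) @ \oo --> 0.
Proof.
move=> Sq; apply: (bounded_sum_cvg0 (fun k => form_ge0 hE _)) => k.
exact: gap_sum_le Sq.
Qed.

Lemma increment_cvg0 q : Se q ->
  (fun k => gdot g (p k.+1 - p k) (p k.+1 - p k)) @ \oo --> 0.
Proof.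
move=> Sq; apply: (bounded_sum_cvg0 (fun k => form_ge0 hE _)) => k.
apply: le_trans (p_bounded k Sq); elim: k => [|k IH].
  by rewrite big_ord0 (form_ge0 hE).
rewrite big_ord_recr /=.
by have := increment_le hE p_acute k; move: IH; lra.
Qed.

(** [|u + v|^2 <= 2 |u|^2 + 2 |v|^2]. *)
Lemma form_sum_cvg0 (u v : nat -> ext) :
  (fun k => gdot g (u k) (u k)) @ \oo --> 0 -> (fun k => gdot g (v k) (v k)) @ \oo --> 0 ->
  (fun k => gdot g (u k + v k) (u k + v k)) @ \oo --> 0.
Proof.
move=> u0 v0.
have h : (fun k => 2 * gdot g (u k) (u k) + 2 * gdot g (v k) (v k)) @ \oo --> 0.
  by rewrite -[X in _ --> X]addr0; apply: cvgD; exact: cvg0_scale.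
apply: squeeze0 h => k; first exact: form_ge0 hE _.
rewrite /=; have := form_ge0 hE (u k - v k).
by move: (u k) (v k) => a b; rewrite !(formE hE) (formC hE b a); lra.
Qed.

Lemma ptilde_cvg0 q : Se q -> (fun k => gdot g (pt k - p k) (pt k - p k)) @ \oo --> 0.
Proof.
move=> Sq; have := form_sum_cvg0 (gap_cvg0 Sq) (increment_cvg0 Sq).
by under [X in X @ _ --> _ -> _]funext do rewrite /inertial_gap addrA subrK.
Qed.

Lemma merit_cvg0 q : Se q -> merit @ \oo --> 0.
Proof.
move=> Sq; set t := 1 - sigma ^+ 2.
have t0 : 0 < t by rewrite subr_gt0 expr_lt1// ltW.
have := cvg0_scale (3 * mx * K / t ^+ 2) (gap_cvg0 Sq).
apply: squeeze0 => k; first exact: merit_ge0.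
rewrite mulrAC ler_pdivlMr ?exprn_gt0// mulrC.
exact: (merit_grad_le k).1.
Qed.

Lemma xgap_cvg0 q i : Se q -> (fun k => `|xgap k i| ^+ 2) @ \oo --> 0.
Proof.
move=> /merit_cvg0/(cvg0_scale (lam i)).
apply: squeeze0 => k; first exact: exprn_ge0.
rewrite /= -ler_pdivrMl ?stepsize_gt0// /merit (bigD1 i)//= lerDl.
apply: sumr_ge0 => i' _.
by rewrite mulr_ge0 ?exprn_ge0// invr_ge0 ltW// stepsize_gt0.
Qed.

Lemma ptilde_bounded q : Se q -> exists m, forall k, gdot g (pt k) (pt k) <= m.
Proof.
move=> Sq; set D := gdot g (q - p 0%N) (q - p 0%N).
exists (4 * (5 / 4 * Om * D) + 4 * D + 2 * gdot g (p 0%N) (p 0%N)) => k.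
have h1 : gdot g (gap k) (gap k) <= 5 / 4 * Om * D.
  apply: le_trans (gap_sum_le k.+1 Sq); rewrite big_ord_recr /= lerDr.
  by apply: sumr_ge0 => l _; exact: form_ge0 hE _.
have h2 := p_bounded k.+1 Sq; rewrite -/D in h2.
have -> : pt k = gap k + (p k.+1 - p 0%N) + p 0%N by rewrite addrA subrK subrK.
move: h1 h2; move: (5 / 4 * Om * D) => m; move: D => D.
  move: (p 0%N) (p k.+1 - p 0%N) (gap k) => c b a.
have := form_ge0 hE (a - b); have := form_ge0 hE (a + b - c).
rewrite !(formE hE) (formC hE b a) (formC hE c a) (formC hE c b).
by lra.
Qed.

(** Moving from [(x_i, y_i)], which almost satisfies the monotonicity
    inequality, to [(G_i z, w_i)] at the extrapolated point costs only inner
    products of the vanishing gaps with bounded vectors. *)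
Lemma separator_ptilde_le k (a b : forall i, hs i) :
  (forall i, Top domF F B (a i) (b i)) ->
  sep a b (pt k) <= \sum_i `|xgap k i| *
    `|(lam i)^-1 *: (G i (zpart (pt k)) - a i) + (b i - wfull Gadj (pt k) i)|.
Proof.
move=> Tab; apply: ler_sum => i _; apply: le_trans (cauchy_schwarz _ _).
have h1 := y_enlarged k (Tab i); have h2 := eps_le k i.
have l0 : 0 <= (lam i)^-1 * `|xgap k i| ^+ 2.
  by rewrite mulr_ge0 ?exprn_ge0// invr_ge0 ltW// stepsize_gt0.
have s1 : sigma ^+ 2 <= 1 by rewrite ltW// expr_lt1// ltW.
have xE : x k i - a i = (G i (zpart (pt k)) - a i) - xgap k i.
  by rewrite /xgap opprB [RHS]addrC addrA subrK.
have yE : y k i - b i = (lam i)^-1 *: xgap k i - (b i - wfull Gadj (pt k) i).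
  by rewrite -y_wfull opprB addrA subrK.
move: h1 l0 h2; rewrite xE yE.
move: (G i (zpart (pt k)) - a i) (xgap k i) (b i - wfull Gadj (pt k) i) (eps k i) => u d v e.
move: (lam i)^-1 => l; rewrite -inner_normE !(formE (hV _)).
rewrite (formC (hV _) d u).
move: '[u, d] '[d, d] '[u, v] '[d, v] => r1 r2 r3 r4 h1 h2 h3.
have : sigma ^+ 2 * (l * r2) <= 1 * (l * r2) by rewrite ler_wpM2r.
by lra.
Qed.

(** The separator is affine, so its value at [p k] differs from the one at the
    extrapolated point by the product of a fixed gradient with a vanishing
    vector. *)
Lemma separator_limit q (a b : forall i, hs i) (e : R) : Se q ->
  (forall i, Top domF F B (a i) (b i)) -> 0 < e ->
  exists N, forall k, (N <= k)%N -> sep a b (p k) <= e.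
Proof.
move=> Sq Tab e0; have [m mP] := ptilde_bounded Sq.
pose c k i := (lam i)^-1 *: (G i (zpart (pt k)) - a i) + (b i - wfull Gadj (pt k) i).
have bound (z r s : R) : 0 <= s -> z ^+ 2 <= s * r -> z <= 1 + s * r.
  by move=> s0 zr; have := sqr_ge0 (z - 1); have := sqr_ge0 z; rewrite sqrrB expr1n; lra.
have /choice[W WP] i : exists W, forall k, `|c k i| <= W.
  have [w wP] := wfull_bound i.
  have lV : 0 <= (lam i)^-1 by rewrite invr_ge0 ltW// stepsize_gt0.
  exists ((lam i)^-1 * ((1 + Gmax2 G / g * m) + `|a i|) + (`|b i| + (1 + `|w| * m))) => k.
  apply: le_trans (ler_normD _ _) _; rewrite normrZ ger0_norm//.
  apply: lerD.
    apply: ler_wpM2l => //; apply: le_trans (ler_normB _ _) _; rewrite lerD2r.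
    have g0 : 0 <= Gmax2 G / g by rewrite divr_ge0 ?(le_trans ler01 Gmax2_ge1)// ltW.
    by apply: bound => //; apply: le_trans (Gz_bound _ _) _; exact: ler_wpM2l.
  apply: le_trans (ler_normB _ _) _; rewrite lerD2l.
  apply: bound => //; apply: le_trans (wP _) _.
  apply: le_trans (ler_wpM2r (form_ge0 hE _) (ler_norm w)) _; exact: ler_wpM2l.
have lim0 : (fun k => \sum_i `|xgap k i| * W i) @ \oo --> 0.
  have z0 : \sum_(i : idx) (0 : R) = 0 by rewrite big1.
  rewrite -[X in _ --> X]z0.
  apply: cvg_big => [|i _]; first exact: add_continuous.
  have /norm2_cvg : (fun k => `|xgap k i - 0| ^+ 2) @ \oo --> 0.
    by under eq_cvg do rewrite subr0; exact: xgap_cvg0 Sq.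
  move=> /cvg_norm; rewrite normr0 => /cvgM/(_ (cvg_cst (W i))).
  by rewrite mul0r; exact.
have e2 : 0 < e / 2 by lra.
have [d d0 dP] := form_small hE (sepgrad G Gadj g a b) e2.
have [N1 N1P] := cvg0_eventually lim0 e2.
have [N2 N2P] := cvg0_eventually (ptilde_cvg0 Sq) d0.
exists (maxn N1 N2) => k; rewrite geq_max => /andP[k1 k2].
have := dP _ (N2P k k2); have := N1P k k1.
have : sep a b (pt k) <= \sum_i `|xgap k i| * W i.
  apply: le_trans (separator_ptilde_le k Tab) _; apply: ler_sum => i _.
  by apply: ler_wpM2l => //; exact: WP.
rewrite !(separatorE G_adjoint G_last _ _ _ g_gt0) (formDr hE _ (pt k)) (formNr hE) ler_norml.
by lra.
Qed.

(** The half-space form of [S_e] puts every common point of the closed convex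
    hulls of the tails of [p] in [S_e], as [haugazeau_cvg] demands. *)
Lemma p_cvg q : Se q -> (forall q', Se q' -> gdot g (p 0%N - q) (q' - q) <= 0) ->
  (fun k => gdot g (p k - q) (p k - q)) @ \oo --> 0.
Proof.
move=> Sq qP; apply/cvgrPdist_le => e e0.
have [] := haugazeau_cvg hE _ qP (fun k => p_bounded k Sq) e0.
  move=> c cP; apply/ext_solutions_separator => a b Tab.
  apply/ler_addgt0Pr => d d0; have d2 : 0 < d / 2 by lra.
  have [N NP] := separator_limit Sq Tab d2.
  have [k /NP] := cP (- sepgrad G Gadj g a b) _ d2 N.
  rewrite !(separatorE G_adjoint G_last _ _ _ g_gt0) !(formE hE).
  by lra.
move=> N NP; exists N => // k /= /NP h.
by rewrite sub0r normrN ger0_norm// (form_ge0 hE).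
Qed.

Lemma wfull_cvg (u : nat -> ext) q i : (fun k => gdot g (u k - q) (u k - q)) @ \oo --> 0 ->
  (fun k => wfull Gadj (u k) i) @ \oo --> wfull Gadj q i.
Proof.
move=> u0; apply: norm2_cvg; have [c cP] := wfull_bound i.
apply: squeeze0 (cvg0_scale c u0) => k; first exact: exprn_ge0.
by rewrite -wfullB; exact: cP.
Qed.

Lemma Gz_cvg (u : nat -> ext) q i : (fun k => gdot g (u k - q) (u k - q)) @ \oo --> 0 ->
  (fun k => G i (zpart (u k))) @ \oo --> G i (zpart q).
Proof.
move=> u0; apply: norm2_cvg.
apply: squeeze0 (cvg0_scale (Gmax2 G / g) u0) => k; first exact: exprn_ge0.
by rewrite -linearB; exact: Gz_bound (u k - q).
Qed.

Lemma strong_convergence q : Se q ->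
  (forall q', Se q' -> gdot g (p 0%N - q) (q' - q) <= 0) ->
  [/\ nearest (@gdist R n H0 H g) Se (p 0%N) q,
      (fun k => gdist g (p k) q) @ \oo --> 0,
      ((fun k => zpart (p k)) @ \oo --> zpart q) /\ solution domF F B G Gadj (zpart q),
      forall i, (fun k => wfull Gadj (p k) i) @ \oo --> wfull Gadj q i
    & forall i, ((fun k => x k i) @ \oo --> G i (zpart q)) /\
        ((fun k => y k i) @ \oo --> wfull Gadj q i)].
Proof.
move=> Sq qP; have p0 := p_cvg Sq qP.
have pt0 : (fun k => gdot g (pt k - q) (pt k - q)) @ \oo --> 0.
  have := form_sum_cvg0 (ptilde_cvg0 Sq) p0.
  by under eq_cvg do rewrite addrA subrK.
have xgap0 i : (fun k => xgap k i) @ \oo --> 0.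
  by apply: norm2_cvg; under eq_cvg do rewrite subr0; exact: xgap_cvg0 Sq.
split.
- by split => //; exact: (d0E Sq qP).1.
- rewrite -[X in _ --> X]sqrtr0.
  exact: cvg_comp p0 (@sqrt_continuous R 0).
- split; last exact: ext_solution_solution.
  have := @Gz_cvg p q None p0; rewrite G_last.
  by under eq_cvg do rewrite G_last.
- by move=> i; exact: wfull_cvg.
move=> i; split.
  rewrite -[X in _ --> X]subr0.
  have -> : x^~ i = (fun k => G i (zpart (pt k)) - xgap k i).
    by apply/funext => k; rewrite /xgap subKr.
  by apply: cvgB; [exact: (@Gz_cvg pt q i pt0)|exact: xgap0].
rewrite -[X in _ --> X]addr0 -[X in _ + X](scaler0 _ (lam i)^-1).
have -> : y^~ i = (fun k => wfull Gadj (pt k) i + (lam i)^-1 *: xgap k i).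
  by apply/funext => k; rewrite -y_wfull addrC subrK.
by apply: cvgD; [exact: (@wfull_cvg pt q i pt0)|apply: cvgZ; [exact: cvg_cst|exact: xgap0]].
Qed.

End Algorithm.

Theorem theorem4p5 (R : realType) (n : nat) (n_ge2 : (2 <= n)%N)
  (H0 : hilbertType R) (H : 'I_n.-1 -> hilbertType R)
  (domF C : forall i : option 'I_n.-1, set (hsp H0 H i))
  (F : forall i : option 'I_n.-1, hsp H0 H i -> hsp H0 H i)
  (B : forall i : option 'I_n.-1, hsp H0 H i -> set (hsp H0 H i))
  (G : forall i : option 'I_n.-1, {linear H0 -> hsp H0 H i})
  (Gadj : forall i : option 'I_n.-1, hsp H0 H i -> H0)
  (L : option 'I_n.-1 -> R)
  (F_continuous : forall i, {within domF i, continuous (F i)})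
  (F_monotone : forall i, monotone_op (single (domF i) (F i)))
  (B_maximal : forall i, maximal_monotone (B i))
  (domB_C : forall i, opdom (B i) `<=` C i)
  (C_domF : forall i, C i `<=` domF i)
  (C_nonempty : forall i, C i !=set0)
  (C_closed : forall i, closed (C i))
  (C_convex : forall i, convex_set (C i))
  (G_bounded : forall i, bounded_near (G i) (nbhs (0 : H0)))
  (G_adjoint : forall i z u, '[G i z, u] = '[z, Gadj i u])
  (G_last : forall z, G None z = z)
  (solvable : exists z, solution domF F B G Gadj z)
  (L_gt0 : forall i, 0 < L i)
  (F_cocoercive : forall i, cocoercive (L i) (domF i) (F i))
  (sigma g : R) (sigma_gt0 : 0 < sigma) (sigma_lt1 : sigma < 1) (g_gt0 : 0 < g)
  (alpha beta : nat -> R)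
  (p : nat -> ext H0 H) (zb x y : nat -> forall i : option 'I_n.-1, hsp H0 H i)
  (alg : algorithm2 C F B G Gadj L sigma g alpha beta p zb x y)
  (alpha_bounded : has_ubound (range alpha))
  (beta_summable : cvgn (series (fun k => beta k ^+ 2))) :
  (exists pstar : ext H0 H,
     [/\ nearest (@gdist R n H0 H g) (ext_solutions domF F B G Gadj) (p 0%N) pstar,
         (fun k => gdist g (p k) pstar) @ \oo --> 0,
         ((fun k => zpart (p k)) @ \oo --> zpart pstar) /\
           solution domF F B G Gadj (zpart pstar),
         forall i, (fun k => wfull Gadj (p k) i) @ \oo --> wfull Gadj pstar i
       & forall i, ((fun k => x k i) @ \oo --> G i (zpart pstar)) /\
           ((fun k => y k i) @ \oo --> wfull Gadj pstar i)])
  /\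
  (let dist := d0 domF F B G Gadj g (p 0%N) in
   let Om := Omega alpha beta in
   let K := n%:R * Gmax2 G *
     Num.max (Lmax L / (2 * sigma ^+ 2)) (2 * sigma ^+ 2 / Lmin L) in
   forall k : nat, exists2 l : nat, (l <= k)%N &
     [/\ forall i, opadd (enlargement (single (domF i) (F i)) (epsk L zb x l i))
           (B i) (x l i) (y l i),
         `|residual Gadj y l| <=
           K * dist / Num.sqrt k.+1%:R *
           (4 * Num.sqrt g * Num.max 1 g^-1 * Num.sqrt Om / (1 - sigma ^+ 2)),
         forall j, `|x l (Some j) - G (Some j) (x l None)| <=
           K * dist / Num.sqrt k.+1%:R *
           (4 * Num.max 1 g^-1 * Num.sqrt Om / (1 - sigma ^+ 2))
       & \sum_i epsk L zb x l i <=
           K * dist ^+ 2 / k.+1%:R *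
           (4 * sigma ^+ 2 * Num.max 1 g^-1 * Om / (1 - sigma ^+ 2) ^+ 2)]).
Proof.
have [pstar Sp pP] := ext_solutions_projection F_monotone B_maximal domB_C C_domF
  C_nonempty C_closed G_adjoint G_last L_gt0 F_cocoercive g_gt0 (p 0%N) solvable.
split; last first.
  move=> dist Om K k.
  exact: (complexity B_maximal domB_C C_domF
    C_convex G_bounded G_adjoint G_last L_gt0 F_cocoercive
    sigma_gt0 sigma_lt1 g_gt0 alg n_ge2 alpha_bounded beta_summable k Sp pP).
exists pstar.
exact: (strong_convergence F_monotone B_maximal domB_C C_domF
    C_nonempty C_closed C_convex G_bounded G_adjoint G_last L_gt0 F_cocoercive
    sigma_gt0 sigma_lt1 g_gt0 alg n_ge2 alpha_bounded beta_summable Sp pP).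
Qed.
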